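(* Let $\Omega\subset\mathbb R^n$ be a bounded domain, let $f$ be continuous and bounded in $\Omega$, and let $u\in C(\overline\Omega)$ be a viscosity solution of the equation $\mathcal M_{\mathbf a}(D^2u)=f$ in $\Omega$. Suppose $\mathcal M_{\mathbf a}\in\overline{\mathcal A}$ with $a_1\ge\hat a_1$, resp. with $a_n\ge\hat a_n$. Set $$\alpha=\max\left(1-\hat a_1/a_1,\ 1-\hat a_n/a_n\right).$$ Consider the uniform exterior sphere condition (S) with radius $R>0$: for all $y\in\partial\Omega$ there is a ball $B_R$ of radius $R$ such that $y\in\partial B_R$ and $\overline\Omega\subset\overline B_R$. Then the following global Hölder estimates hold. (A) If $\Omega$ satisfies (S) with radius $R$ and $u=g$ on $\partial\Omega$ with $g\in C^\beta(\partial\Omega)$, $\beta\in(0,1]$, then $u\in C^\gamma(\overline\Omega)$ with $\gamma=\min(\alpha,\beta/2)$ and $[u]_{\gamma,\Omega}\le C(\|g\|_{C^\beta(\partial\Omega)}+\|f\|_{L^\infty(\Omega)})$. If in addition $\Omega$ has a uniform Lipschitz boundary with Lipschitz constant $L$ and $u=g$ on $\partial\Omega$ with $g\in C^{1,\beta}(\partial\Omega)$, $\beta\in[0,1)$, then $u\in C^\gamma(\overline\Omega)$ with $\gamma=\min(\alpha,(1+\beta)/2)$ and $[u]_{\gamma,\Omega}\le C(\|g\|_{C^{1,\beta}(\partial\Omega)}+\|f\|_{L^\infty(\Omega)})$. Here $C$ depends only on $n$, $a_1$, $\hat a_1$, $a_n$, $\hat a_n$, $\tilde a$, $R$, $\beta$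 (and $L$ in the second case). (B) In particular: (i) Suppose that $\Omega$ satisfies (S) with radius $R>0$. If $u=g$ on $\partial\Omega$ with $g\in C^{2\alpha}(\partial\Omega)$ and $\alpha\in(0,1/2]$, then $u\in C^\alpha(\overline\Omega)$ and $$[u]_{\alpha,\Omega}\le C\left(\|g\|_{C^{2\alpha}(\partial\Omega)}+\|f\|_{L^\infty(\Omega)}\right),$$ where $C$ is a positive constant depending only on $n$, $a_1$, $\hat a_1$, $a_n$, $\hat a_n$, $\tilde a$, $R$ and $\alpha$. (ii) Suppose in addition that $\Omega$ has a uniform Lipschitz boundary with Lipschitz constant $L$. If $u=g$ on $\partial\Omega$ with $g\in C^{1,2\alpha-1}(\partial\Omega)$ and $\alpha\in[1/2,1]$, then $$[u]_{\alpha,\Omega}\le C\left(\|g\|_{C^{1,2\alpha-1}(\partial\Omega)}+\|f\|_{L^\infty(\Omega)}\right),$$ where $C$ is a positive constant also depending on $L$.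
   Context: For a real symmetric $n\times n$ matrix $X\in\mathcal S^n$, let $\lambda_1(X)\le\dots\le\lambda_n(X)$ be its eigenvalues. For $\mathbf a=(a_1,\dots,a_n)$ with $a_i\ge0$ for all $i$ and at least one $a_j>0$, set $\mathcal M_{\mathbf a}(X)=\sum_{i=1}^n a_i\lambda_i(X)$. $\overline{\mathcal A}$ is the class of all such operators. $|\mathbf a|=a_1+\dots+a_n$, $\hat a_j=|\mathbf a|-a_j$, $\tilde a=|\mathbf a|/n$. In the definition of $\alpha$, a term with zero denominator is disregarded (counted as $-\infty$). Hölder notation: for $h:D\to\mathbb R$, $D\subset\mathbb R^n$, $[h]_{\gamma,D}=\sup_{x\ne y\in D}|h(x)-h(y)|/|x-y|^\gamma$ (same for vector-valued $h$). $\|g\|_{C^\beta(\partial\Omega)}=\sup_{\partial\Omega}|g|+[g]_{\beta,\partial\Omega}$. $g\in C^{1,\beta}(\partial\Omega)$ means that $g$ is the restriction of a $C^{1,\beta}$ function defined near $\partial\Omega$, $Dg$ denotes its gradient, and $\|g\|_{C^{1,\beta}(\partial\Omega)}=\sup_{\partial\Omega}|g|+\sup_{\partial\Omega}|Dg|+[Dg]_{\beta,\partial\Omega}$. Viscosity notions: for an open set $\Omega$, an upper semicontinuous $u$ is a viscosity subsolution of $\mathcal M_{\mathbf a}(D^2u)=f$ (also written $\mathcal M_{\mathbf a}(D^2u)\ge f$) in $\Omega$ if $\mathcal M_{\mathbf a}(X)\ge f(x)$ for all $x\in\Omega$ and all $(\xi,X)\in\mathbb R^n\times\mathcal S^n$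 such that $u(y)\le u(x)+\langle\xi,y-x\rangle+\frac12\langle X(y-x),y-x\rangle+o(|y-x|^2)$ as $y\to x$. A lower semicontinuous $u$ is a viscosity supersolution (written $\mathcal M_{\mathbf a}(D^2u)\le f$) if $\mathcal M_{\mathbf a}(X)\le f(x)$ for all $x\in\Omega$ and all $(\xi,X)$ such that $u(y)\ge u(x)+\langle\xi,y-x\rangle+\frac12\langle X(y-x),y-x\rangle+o(|y-x|^2)$ as $y\to x$. A viscosity solution is a continuous function that is both a sub- and a supersolution.
   Formalization: The two assertions with Lipschitz boundary and C^{1,β} (resp. C^{1,2α-1}) data are stated for n ≥ 2; for n = 1 the estimate fails, e.g. on (0,ε) with R = 1, f = 0, g = 0 near 0, g = 1 near ε, u = x/ε as ε → 0. *)

(* Defs.v *)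
From HB Require Import structures.
From mathcomp Require Import all_boot all_order all_algebra.
From mathcomp Require complex.
From mathcomp Require Import all_classical all_reals all_analysis.

Set Implicit Arguments.
Unset Strict Implicit.
Unset Printing Implicit Defensive.

Import Order.TTheory GRing.Theory Num.Theory.
Import numFieldNormedType.Exports.
Local Open Scope classical_set_scope.
Local Open Scope ring_scope.

(* The library norm of ['rV[R]_n] is the max norm, so the Euclidean structure
   is defined here; both norms induce the same topology, hence the library
   notions of open, closed, bounded, connected sets, limits and continuity
   apply unchanged. *)
Section Euclidean.
Variables (R : realType) (n : nat).
Implicit Types v w : 'rV[R]_n.

Definition dotp v w : R := \sum_i v 0 i * w 0 i.
Definition enorm v : R := Num.sqrt (dotp v v).

End Euclidean.

Section Eigenvalues.
Variables (R : realType) (n : nat).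
Implicit Types X : 'M[R]_n.

(* Eigenvalues are counted with multiplicity; see [eigenvaluesP]. *)
Definition is_eigenvalues X (s : n.-tuple R) : Prop :=
  sorted <=%R s /\ char_poly X = \prod_(x <- s) ('X - x%:P).

Definition eigenvalues X : n.-tuple R :=
  xget [tuple of nseq n 0] [set s | is_eigenvalues X s].

Definition lambda X (i : 'I_n) : R := tnth (eigenvalues X) i.

End Eigenvalues.

Section WeightedSums.
Variables (R : realType) (n : nat).
(* The dimension of the space is [n.+1]; the indices 1, ..., n of the
   mathematical text are [ord0], ..., [ord_max]. *)
Implicit Types a : 'I_n.+1 -> R.

Definition M_op a (X : 'M[R]_n.+1) : R := \sum_i a i * lambda X i.

Definition weights a : Prop := (forall i, 0 <= a i) /\ exists j, 0 < a j.

Definition wsum a : R := \sum_i a i.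
Definition what a (j : 'I_n.+1) : R := wsum a - a j.
Definition wmean a : R := wsum a / n.+1%:R.

Definition alpha_term a (j : 'I_n.+1) : \bar R :=
  if a j == 0 then -oo%E else (1 - what a j / a j)%:E.
Definition alpha a : R :=
  fine (Order.max (alpha_term a ord0) (alpha_term a ord_max)).

Definition weight_data a : R * R * R * R * R :=
  (a ord0, what a ord0, a ord_max, what a ord_max, wmean a).

End WeightedSums.

Section Viscosity.
Variables (R : realType) (n : nat).
Implicit Types (F : 'M[R]_n -> R) (Omega : set 'rV[R]_n) (u f : 'rV[R]_n -> R).

Definition taylor2 u (x xi : 'rV[R]_n) (X : 'M[R]_n) (y : 'rV[R]_n) : R :=
  u x + dotp xi (y - x) + 2^-1 * dotp ((y - x) *m X) (y - x).

(* [u y <= taylor2 u x xi X y + o(|y - x|^2)] as [y --> x] *)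
Definition super_jet u x xi X : Prop := forall e : R, 0 < e ->
  \forall y \near x, u y <= taylor2 u x xi X y + e * enorm (y - x) ^+ 2.

(* [u y >= taylor2 u x xi X y + o(|y - x|^2)] as [y --> x] *)
Definition sub_jet u x xi X : Prop := forall e : R, 0 < e ->
  \forall y \near x, taylor2 u x xi X y - e * enorm (y - x) ^+ 2 <= u y.

Definition usc_on Omega u : Prop := forall x, Omega x -> forall e : R, 0 < e ->
  \forall y \near within Omega (nbhs x), u y < u x + e.
Definition lsc_on Omega u : Prop := forall x, Omega x -> forall e : R, 0 < e ->
  \forall y \near within Omega (nbhs x), u x - e < u y.

Definition viscosity_subsolution F f Omega u : Prop :=
  usc_on Omega u /\
  forall x xi X, Omega x -> X^T = X -> super_jet u x xi X -> f x <= F X.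

Definition viscosity_supersolution F f Omega u : Prop :=
  lsc_on Omega u /\
  forall x xi X, Omega x -> X^T = X -> sub_jet u x xi X -> F X <= f x.

Definition viscosity_solution F f Omega u : Prop :=
  [/\ {within Omega, continuous u},
      viscosity_subsolution F f Omega u &
      viscosity_supersolution F f Omega u].

End Viscosity.

Section Hoelder.
Variables (R : realType) (n : nat).
Implicit Types (D : set 'rV[R]_n) (g : 'rV[R]_n -> R).

(* [N] is the norm of the target: the absolute value for scalar functions,
   [@enorm R n] for gradients.  The suprema are -oo if [D] is empty, resp. has
   at most one point; this does not happen for a bounded nonempty open set nor
   for its boundary. *)
Definition sup_norm (V : Type) (N : V -> R) D (h : 'rV[R]_n -> V) : \bar R :=
  ereal_sup [set (N (h x))%:E | x in D].

Definition hoelder_seminorm (V : zmodType) (N : V -> R) (gamma : R) D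
    (h : 'rV[R]_n -> V) : \bar R :=
  ereal_sup [set (N (h p.1 - h p.2) / enorm (p.1 - p.2) `^ gamma)%:E
            | p in [set p | [/\ D p.1, D p.2 & p.1 != p.2]]].

Definition abs_norm (x : R) : R := `|x|.

Definition C_norm beta D g : \bar R :=
  (sup_norm abs_norm D g + hoelder_seminorm abs_norm beta D g)%E.

Definition grad g (x : 'rV[R]_n) : 'rV[R]_n :=
  \row_i 'D_(delta_mx 0 i) g x.

Definition C1_norm beta D g : \bar R :=
  (sup_norm abs_norm D g + sup_norm (@enorm R n) D (grad g)
   + hoelder_seminorm (@enorm R n) beta D (grad g))%E.

(* [g] is of class C^{1,beta} in a neighbourhood [N] of [D].  Continuity of the
   gradient is a separate requirement because it does not follow from the
   finiteness of the seminorm when [beta = 0]. *)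
Definition C1_near beta D g : Prop :=
  exists N : set 'rV[R]_n,
    [/\ open N, D `<=` N,
        forall x, N x -> differentiable g x,
        {within N, continuous (grad g)} &
        (hoelder_seminorm (@enorm R n) beta N (grad g) < +oo)%E].

End Hoelder.

Section Domains.
Variables (R : realType).

Definition boundary n (Omega : set 'rV[R]_n) : set 'rV[R]_n :=
  closure Omega `\` interior Omega.

Definition bounded_domain n (Omega : set 'rV[R]_n) : Prop :=
  [/\ open Omega, connected Omega, Omega !=set0 & bounded_set Omega].

Definition sphere_condition n (rho : R) (Omega : set 'rV[R]_n) : Prop :=
  forall y, boundary Omega y -> exists z,
    enorm (y - z) = rho /\ closure Omega `<=` [set x | enorm (x - z) <= rho].

(* In a ball of radius [r], independent of the boundary point, and in the
   orthonormal coordinates [x *m Q], the domain is the strict epigraph of an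
   [L]-Lipschitz function of the first [n] coordinates. *)
Definition uniform_lipschitz_boundary n (L : R) (Omega : set 'rV[R]_n.+1) :
    Prop :=
  exists2 r : R, 0 < r & forall y, boundary Omega y ->
    exists (Q : 'M[R]_n.+1) (phi : 'rV[R]_n -> R),
      [/\ Q *m Q^T = 1%:M,
          forall s t, `|phi s - phi t| <= L * enorm (s - t) &
          forall x, enorm (x - y) < r ->
            (Omega x <->
             phi (col' ord_max (x *m Q)) < (x *m Q) 0 ord_max)].

End Domains.

Section EigenvaluesFacts.
Import complex.

Lemma char_poly_conj (F : fieldType) n (P A : 'M[F]_n) : P \in unitmx ->
  char_poly (invmx P *m A *m P) = char_poly A.
Proof.
move=> uP; rewrite /char_poly.
have -> : char_poly_mx (invmx P *m A *m P) =
    map_mx polyC (invmx P) *m char_poly_mx A *m map_mx polyC P.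
  rewrite /char_poly_mx mulmxBr mulmxBl !map_mxM /=; congr (_ - _).
  by rewrite scalar_mxC -mulmxA -map_mxM mulVmx // map_mx1 mulmx1.
rewrite !det_mulmx mulrAC -det_mulmx -map_mxM mulVmx // map_mx1 det1.
by rewrite mul1r.
Qed.

Variables (R : realType) (n : nat).
Local Notation C := (complex.complex (R : rcfType) : numClosedFieldType).
Local Notation toC :=
  (@complex.real_complex_def R (Phant R) : {rmorphism R -> C}).

Lemma is_eigenvalues_exists (X : 'M[R]_n) : X^T = X ->
  exists s, is_eigenvalues X s.
Proof.
move=> sX; pose A : 'M[C]_n := map_mx toC X.
have hA : A \is hermsymmx.
  apply: realsym_hermsym.
    by apply/is_hermitianmxP; rewrite expr0 scale1r map_mx_id // map_trmx sX.
  apply/mxOverP => i j; rewrite mxE; apply/complex.complex_realP.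
  by exists (X i j).
have /mxOverP Dreal := hermitian_spectral_diag_real hA.
have /orthomx_spectralP defA := hermitian_normalmx hA.
pose d i := complex.Re (spectral_diag A 0 i).
have dE i : toC (d i) = spectral_diag A 0 i.
  exact/complex.RRe_real/Dreal.
exists (sort_tuple <=%R [tuple d i | i < n]); split.
  by rewrite /= sort_sorted //; exact: le_total.
apply: (map_poly_inj toC).
rewrite map_char_poly -/A defA char_poly_conj ?spectral_unit //.
rewrite char_poly_trig; last first.
  by apply/is_trig_mxP => i j ij; rewrite mxE -val_eqE (ltn_eqF ij).
have /= -> := perm_big [seq d i | i <- enum 'I_n]; last by rewrite perm_sort.
rewrite big_map big_enum /= rmorph_prod; apply: eq_bigr => i _.
by rewrite rmorphB /= map_polyX map_polyC /= dE mxE eqxx.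
Qed.

Lemma is_eigenvalues_unique (X : 'M[R]_n) s t :
  is_eigenvalues X s -> is_eigenvalues X t -> s = t.
Proof.
move=> [ss Xs] [st Xt]; apply/val_inj/(sorted_eq le_trans le_anti ss st).
by apply: prod_XsubC_eq; rewrite -Xs -Xt.
Qed.

Lemma eigenvaluesP (X : 'M[R]_n) : X^T = X ->
  is_eigenvalues X (eigenvalues X).
Proof. by move=> /is_eigenvalues_exists; exact: xgetPex. Qed.

End EigenvaluesFacts.

(* Main.v *)
Require Import Defs.
From HB Require Import structures.
From mathcomp Require Import all_boot all_order all_algebra.
From mathcomp Require Import all_classical all_reals all_analysis.
From mathcomp Require Import ring lra.

Set Implicit Arguments.
Unset Strict Implicit.
Unset Printing Implicit Defensive.

Import Order.TTheory GRing.Theory Num.Theory.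
Import numFieldNormedType.Exports.
Local Open Scope classical_set_scope.
Local Open Scope ring_scope.

(** Let [K] be the closure of the domain and [|a|] the total weight.  All barriers
    are smooth where they are used, so that comparison needs no uniqueness
    theory: a maximum point of [u - phi] is itself a test point
    ([comparison]).

    The sphere condition is a quantitative convexity.  If [y] is a boundary
    point and [z] the centre of its enclosing ball, the affine function
    [depth y z x = <y - x, y - z>] satisfies
    [|x - y|^2 <= 2 depth <= 2 rho |x - y|] on [K].  A modulus [|x - y|^beta] of
    the boundary data is therefore at most [(2 depth)^(beta / 2)], a concave
    function of an affine one, hence an infimum of affine functions.  Each of
    these, corrected by a multiple [B] of the nonnegative function
    [2 depth - |x - y|^2], is a quadratic barrier with Hessian [- 2 B I], on
    which the operator takes the value [- 2 B |a|].  This gives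
    [boundary_estimate] and the exponent [beta / 2].

    If the data have a Hoelder continuous gradient, subtracting the linear part
    at [y] leaves a remainder that is at most a multiple of
    [(2 depth)^((1 + beta) / 2)] ([taylor_boundary_depth]), and the same barriers
    apply.  The gradient is controlled only on the boundary, so the remainder is
    estimated along a path in the boundary.  A path of length comparable to the
    square root of the depth is found outside the domain, and the projection
    onto the convex set [K], which does not increase lengths, carries it into
    the boundary ([boundary_variation]).

    In the interior, the cone [|x - y|^gam] has one radial eigenvalue
    [gam (gam - 1) r^(gam - 2)], the smallest, and all others equal to
    [gam r^(gam - 2)].  The operator is nonpositive on it exactly when
    [what a ord0 <= (1 - gam) * a ord0], that is when [gam] is at most the term
    of [alpha] that belongs to [ord0].  Comparing [u] with such cones, with
    vertex at an arbitrary interior point, transports the boundary estimate to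
    the interior ([interior_estimate], [holder_closure]).  If instead the
    largest eigenvalue carries the dominant weight, the same is done for [- u]
    and the dual operator. *)

(** * Euclidean structure *)

Section EuclideanGeometry.
Variables (R : realType) (m : nat).
Implicit Types v w x y z : 'rV[R]_m.

Lemma dotpC v w : dotp v w = dotp w v.
Proof. by apply: eq_bigr => i _; rewrite mulrC. Qed.

Lemma dotpDl v w z : dotp (v + w) z = dotp v z + dotp w z.
Proof. by rewrite /dotp -big_split; apply: eq_bigr => i _; rewrite mxE mulrDl. Qed.

Lemma dotpZl (c : R) v w : dotp (c *: v) w = c * dotp v w.
Proof. by rewrite /dotp mulr_sumr; apply: eq_bigr => i _; rewrite mxE mulrA. Qed.

Lemma dotpNl v w : dotp (- v) w = - dotp v w.
Proof. by rewrite -scaleN1r dotpZl mulN1r. Qed.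

Lemma dotpBl v w z : dotp (v - w) z = dotp v z - dotp w z.
Proof. by rewrite dotpDl dotpNl. Qed.

Lemma dotpDr v w z : dotp z (v + w) = dotp z v + dotp z w.
Proof. by rewrite !(dotpC z) dotpDl. Qed.

Lemma dotpZr (c : R) v w : dotp w (c *: v) = c * dotp w v.
Proof. by rewrite !(dotpC w) dotpZl. Qed.

Lemma dotpNr v w : dotp w (- v) = - dotp w v.
Proof. by rewrite !(dotpC w) dotpNl. Qed.

Lemma dotpBr v w z : dotp z (v - w) = dotp z v - dotp z w.
Proof. by rewrite dotpDr dotpNr. Qed.

Definition dotpE := (dotpDl, dotpDr, dotpNl, dotpNr, dotpZl, dotpZr).

Lemma dotp0l w : dotp 0 w = 0.
Proof. by rewrite -(scale0r 0) dotpZl mul0r. Qed.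

Lemma dotp_sqrD v w : dotp (v + w) (v + w) = dotp v v + 2 * dotp w v + dotp w w.
Proof. by rewrite !dotpE (dotpC v w); ring. Qed.

Lemma dotp_ge0 v : 0 <= dotp v v.
Proof. by apply: sumr_ge0 => i _; rewrite -expr2 sqr_ge0. Qed.

Lemma dotp_eq0 v : dotp v v = 0 -> v = 0.
Proof.
move=> /eqP; rewrite psumr_eq0 => [/allP v0|i _]; last by rewrite -expr2 sqr_ge0.
apply/rowP => i; rewrite mxE; have := v0 i (mem_index_enum i).
by rewrite -expr2 sqrf_eq0 => /eqP.
Qed.

Lemma dotp_mulmx v w : v *m w^T = (dotp v w)%:M.
Proof.
by apply/matrixP => i j; rewrite !ord1 !mxE eqxx; apply: eq_bigr => k _; rewrite mxE.
Qed.

Lemma enorm_ge0 v : 0 <= enorm v.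
Proof. exact: sqrtr_ge0. Qed.

Lemma enorm_sqr v : enorm v ^+ 2 = dotp v v.
Proof. by rewrite sqr_sqrtr ?dotp_ge0. Qed.

Lemma enorm0 : enorm (0 : 'rV[R]_m) = 0.
Proof. by rewrite /enorm dotp0l sqrtr0. Qed.

Lemma enorm_eq0 v : enorm v = 0 -> v = 0.
Proof. by move=> v0; apply: dotp_eq0; rewrite -enorm_sqr v0 expr0n. Qed.

Lemma enorm_gt0 v : v != 0 -> 0 < enorm v.
Proof.
move=> v0; rewrite lt_neqAle enorm_ge0 andbT eq_sym.
by apply: contra v0 => /eqP /enorm_eq0 ->.
Qed.

Lemma enormZ (c : R) v : enorm (c *: v) = `|c| * enorm v.
Proof. by rewrite /enorm dotpZl dotpZr mulrA -expr2 sqrtrM ?sqr_ge0 // sqrtr_sqr. Qed.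

Lemma enormN v : enorm (- v) = enorm v.
Proof. by rewrite -scaleN1r enormZ normrN1 mul1r. Qed.

Lemma enormBC v w : enorm (v - w) = enorm (w - v).
Proof. by rewrite -enormN opprB. Qed.

Lemma CauchySchwarz_dotp v w : `|dotp v w| <= enorm v * enorm w.
Proof.
rewrite -(@ler_pXn2r _ 2) ?nnegrE ?mulr_ge0 ?enorm_ge0 //.
rewrite real_normK ?num_real // exprMn !enorm_sqr.
have [/dotp_eq0 ->|w0] := eqVneq (dotp w w) 0.
  by rewrite dotpC !dotp0l mulr0 expr0n.
have wp : 0 < dotp w w by rewrite lt_neqAle eq_sym w0 dotp_ge0.
have := dotp_ge0 (dotp w w *: v - dotp v w *: w).
rewrite !dotpE !(dotpC w v) => h.
have : 0 <= dotp w w * (dotp v v * dotp w w - dotp v w ^+ 2) by apply: le_trans h _; lra.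
by rewrite pmulr_rge0 // subr_ge0.
Qed.

Lemma dotp_le v w : dotp v w <= enorm v * enorm w.
Proof. exact: le_trans (ler_norm _) (CauchySchwarz_dotp _ _). Qed.

Lemma enorm_le (v : 'rV[R]_m) (c : R) : 0 <= c -> dotp v v <= c ^+ 2 -> enorm v <= c.
Proof. by move=> c0; rewrite -enorm_sqr ler_pXn2r ?nnegrE ?enorm_ge0. Qed.

Lemma ler_enormD v w : enorm (v + w) <= enorm v + enorm w.
Proof.
apply: enorm_le; first by rewrite addr_ge0 ?enorm_ge0.
by rewrite !dotpE (dotpC w v) -!enorm_sqr; have := dotp_le v w; nra.
Qed.

Lemma ler_enorm_dist y x z : enorm (x - z) <= enorm (x - y) + enorm (y - z).
Proof. by apply: le_trans (ler_enormD _ _); rewrite addrA subrK. Qed.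

Lemma continuous_dotp (T : topologicalType) (f g : T -> 'rV[R]_m) :
  continuous f -> continuous g -> continuous (fun t => dotp (f t) (g t)).
Proof.
move=> cf cg t; apply: cvg_big => [|i _]; first exact: add_continuous.
have coordc (h : T -> 'rV[R]_m) : continuous h -> h s 0 i @[s --> t] --> h t 0 i.
  by move=> ch; exact: (continuous_comp (ch t) (@coord_continuous _ _ _ 0 i (h t))).
by apply: cvgM; exact: coordc.
Qed.

Lemma continuous_enorm (T : topologicalType) (f : T -> 'rV[R]_m) :
  continuous f -> continuous (fun t => enorm (f t)).
Proof.
move=> cf t.
exact: (continuous_comp (continuous_dotp cf cf (x := t)) (@sqrt_continuous R _)).
Qed.

Lemma near_enorm_lt x (e : R) : 0 < e -> \forall y \near x, enorm (y - x) < e.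
Proof.
move=> e0; have cy : continuous (fun y : 'rV[R]_m => y - x).
  by move=> y; apply: (@continuousB _ _ _ id (cst x)); [exact: id | exact: cst_continuous].
have := continuous_enorm cy (x := x); rewrite /continuous_at subrr enorm0.
move=> /cvgrPdist_lt /(_ e e0); apply: filterS => y.
by rewrite sub0r normrN ger0_norm ?enorm_ge0.
Qed.

End EuclideanGeometry.

(** * Eigenvalues of rank-one perturbations of scalar matrices *)

Section RankOnePerturbation.
Variables (R : realType) (n : nat).
Implicit Types (p : 'rV[R]_n.+1) (a : 'I_n.+1 -> R).

Definition rank1 (c q : R) p : 'M[R]_n.+1 := c%:M + q *: (p^T *m p).

Lemma rank1_sym c q p : (rank1 c q p)^T = rank1 c q p.
Proof. by rewrite /rank1 linearD linearZ /= tr_scalar_mx trmx_mul trmxK. Qed.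

Lemma rank1N c q p : - rank1 c q p = rank1 (- c) (- q) p.
Proof. by rewrite /rank1 opprD scaleNr raddfN. Qed.

Lemma mul_rank1 c q p v : v *m rank1 c q p = c *: v + (q * dotp v p) *: p.
Proof.
rewrite /rank1 mulmxDr mul_mx_scalar -scalemxAr mulmxA dotp_mulmx.
by rewrite mul_scalar_mx scalerA.
Qed.

Lemma eigenvalues_mem (X : 'M[R]_n.+1) i : X^T = X -> eigenvalue X (lambda X i).
Proof.
move=> /eigenvaluesP [_ charX].
by rewrite eigenvalue_root_char charX root_prod_XsubC mem_tnth.
Qed.

Lemma lambda_le (X : 'M[R]_n.+1) (i j : 'I_n.+1) :
  X^T = X -> (i <= j)%N -> lambda X i <= lambda X j.
Proof.
move=> /eigenvaluesP [sX _] ij; rewrite /lambda !(tnth_nth 0).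
by apply: sorted_leq_nth => //; rewrite ?inE ?size_tuple //; exact: le_trans.
Qed.

Lemma sum_lambda (X : 'M[R]_n.+1) : X^T = X -> \sum_i lambda X i = \tr X.
Proof.
move=> /eigenvaluesP [_ charX].
have := char_poly_trace X (ltn0Sn n); rewrite charX.
have sz : size (eigenvalues X) = n.+1 by rewrite size_tuple.
have := @coefPn_prod_XsubC R (eigenvalues X); rewrite sz => /(_ isT) -> /oppr_inj <-.
by rewrite big_tuple.
Qed.

(** An eigenvector is either orthogonal to [p] or has a nonzero component along
    [p]; pairing the eigenvalue equation with [p] decides the eigenvalue. *)
Lemma lambda_rank1 c q p i :
  lambda (rank1 c q p) i = c \/ lambda (rank1 c q p) i = c + q * dotp p p.
Proof.
have /eigenvalueP [v] := eigenvalues_mem i (rank1_sym c q p).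
set l := lambda _ i; rewrite mul_rank1 => e v0.
have [vp|vp] := eqVneq (dotp v p) 0.
  left; apply/eqP; rewrite -subr_eq0; apply: contraNT v0 => lc.
  have : (l - c) *: v == 0 by rewrite scalerBl -e vp mulr0 scale0r addr0 subrr.
  by rewrite scaler_eq0 (negbTE lc).
right; have := congr1 (fun w => dotp w p) e; rewrite /= !dotpE => e'.
by apply: (mulIf vp); rewrite -e'; ring.
Qed.

Lemma trace_rank1 c q p : \tr (rank1 c q p) = c *+ n.+1 + q * dotp p p.
Proof.
by rewrite /rank1 mxtraceD mxtrace_scalar mxtraceZ mxtrace_mulC dotp_mulmx mxtrace_scalar.
Qed.

(** The trace counts multiplicities: at most one eigenvalue differs from [c],
    which pins the extreme one without computing the characteristic
    polynomial. *)
Lemma sum_lambda_rank1 c q p :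
  \sum_i (lambda (rank1 c q p) i - c) = q * dotp p p.
Proof.
rewrite big_split /= sum_lambda ?rank1_sym // trace_rank1 sumr_const card_ord.
by rewrite mulNrn addrAC subrr add0r.
Qed.

Lemma M_op_rank1 a c q p : M_op a (rank1 c q p) =
  wsum a * c + \sum_i a i * (lambda (rank1 c q p) i - c).
Proof.
rewrite /M_op /wsum mulr_suml -big_split; apply: eq_bigr => i _ /=; ring.
Qed.

(** A downward rank-one perturbation moves only the smallest eigenvalue, which
    carries the weight [a ord0]. *)
Lemma M_op_rank1_le a c q p : (forall i, 0 <= a i) -> q <= 0 ->
  M_op a (rank1 c q p) <= wsum a * c + a ord0 * (q * dotp p p).
Proof.
move=> a0 q0; rewrite M_op_rank1 lerD2l.
have s0 : q * dotp p p <= 0 by rewrite mulr_le0_ge0 ?dotp_ge0.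
have le0 i : lambda (rank1 c q p) i - c <= 0.
  by case: (lambda_rank1 c q p i) => ->; lra.
have l0 : lambda (rank1 c q p) ord0 - c = q * dotp p p.
  have s := sum_lambda_rank1 c q p.
  case: (lambda_rank1 c q p ord0) => l0; last by rewrite l0; ring.
  apply/eqP; rewrite eq_le l0 subrr s0 andbT -s.
  apply: sumr_ge0 => i _; rewrite subr_ge0.
  by rewrite -[X in X <= _]l0 lambda_le ?rank1_sym.
rewrite (bigD1 ord0) //= l0 gerDl; apply: sumr_le0 => i _.
by rewrite mulr_ge0_le0.
Qed.

(** Mirror image of the preceding estimate: an upward perturbation moves the
    largest eigenvalue. *)
Lemma M_op_rank1_ge a c q p : (forall i, 0 <= a i) -> 0 <= q ->
  wsum a * c + a ord_max * (q * dotp p p) <= M_op a (rank1 c q p).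
Proof.
move=> a0 q0; rewrite M_op_rank1 lerD2l.
have s0 : 0 <= q * dotp p p by rewrite mulr_ge0 ?dotp_ge0.
have ge0 i : 0 <= lambda (rank1 c q p) i - c.
  by case: (lambda_rank1 c q p i) => ->; lra.
have ln : lambda (rank1 c q p) ord_max - c = q * dotp p p.
  have s := sum_lambda_rank1 c q p.
  case: (lambda_rank1 c q p ord_max) => ln; last by rewrite ln; ring.
  apply/eqP; rewrite eq_le ln subrr s0 /= -s.
  apply: sumr_le0 => i _; rewrite subr_le0.
  by rewrite -[X in _ <= X]ln lambda_le ?rank1_sym ?leq_ord.
rewrite (bigD1 ord_max) //= ln lerDl; apply: sumr_ge0 => i _.
by rewrite mulr_ge0.
Qed.

End RankOnePerturbation.

(** * Domains enclosed by balls: depth, convexity, projection *)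

Section EnclosedDomain.
Variables (R : realType) (n : nat) (Omega : set 'rV[R]_n.+1) (rho : R).
Hypotheses (domO : bounded_domain Omega) (rho0 : 0 < rho).
Hypothesis sphO : sphere_condition rho Omega.
Implicit Types a b v w x y z p k : 'rV[R]_n.+1.
Local Notation K := (closure Omega).

(** [z] is the centre of a ball of radius [rho] that contains the closed domain
    and has [y] on its sphere. *)
Definition enclosing_center y z :=
  enorm (y - z) = rho /\ K `<=` [set x | enorm (x - z) <= rho].

(** [depth y z x] is [rho] times the distance from [x] to the hyperplane that
    touches the enclosing sphere at [y]; it is affine in [x]. *)
Definition depth y z x : R := dotp (y - x) (y - z).

Let openO : open Omega. Proof. by case: domO. Qed.

Lemma boundaryP y : boundary Omega y <-> K y /\ ~ Omega y.
Proof. by rewrite /boundary (_ : Omega^° = Omega) //; apply/interior_id. Qed.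

(** The gap [rho^2 - |x - z|^2] is the difference of twice the depth and
    [|x - y|^2]: this identity turns the enclosing ball into a quadratic bound
    by an affine function. *)
Lemma dist_sqr_center y z x : enorm (y - z) = rho ->
  dotp (x - z) (x - z) = rho ^+ 2 - 2 * depth y z x + dotp (x - y) (x - y).
Proof.
move=> <-; rewrite enorm_sqr /depth !dotpE (dotpC z x) (dotpC y x) (dotpC z y); ring.
Qed.

Lemma depth_combination y z x x' s :
  depth y z (x + s *: (x' - x)) = (1 - s) * depth y z x + s * depth y z x'.
Proof. by rewrite /depth !dotpE; ring. Qed.

Lemma depth_self y z : depth y z y = 0.
Proof. by rewrite /depth !dotpE; ring. Qed.

Lemma continuous_line a v : continuous (fun t : R => a + t *: v).
Proof.
by move=> t; apply: cvgD; [exact: cvg_cst | apply: cvgZr_tmp; exact: cvg_id].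
Qed.

Lemma open_line (A : set 'rV[R]_n.+1) a v : open A -> A a ->
  exists2 t, 0 < t & A (a + t *: v).
Proof.
move=> oA Aa.
have : \forall t \near (0 : R), A (a + t *: v).
  have /(_ A) := @continuous_line a v 0; apply; rewrite scale0r addr0.
  exact: open_nbhs_nbhs.
move=> /nbhs_ballP [e /= e0 h]; exists (e / 2); first by rewrite divr_gt0.
by apply: h; rewrite /ball /= sub0r normrN gtr0_norm; lra.
Qed.

(** If [x] were on the sphere, a small outward radial displacement would stay in
    the open domain but leave the ball. *)
Lemma enclosing_center_interior y z x : enclosing_center y z -> Omega x ->
  enorm (x - z) < rho.
Proof.
move=> [_ Kz] Ox; rewrite lt_neqAle; apply/andP; split; last first.
  exact: Kz (subset_closure Ox).
apply/eqP => xz; have [t t0 Ot] := open_line (x - z) openO Ox.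
have /= := Kz _ (subset_closure Ot).
have -> : x + t *: (x - z) - z = (1 + t) *: (x - z).
  by rewrite scalerDl scale1r addrAC.
rewrite enormZ xz gtr0_norm; last lra.
by apply/negP; rewrite -ltNge mulrDl mul1r ltrDl mulr_gt0.
Qed.

Lemma dist_sqr_le_depth y z x : enclosing_center y z -> K x ->
  dotp (x - y) (x - y) <= 2 * depth y z x.
Proof.
move=> [yz Kz] /Kz /= xz; have := dist_sqr_center x yz; rewrite -enorm_sqr.
have := enorm_ge0 (x - z); nra.
Qed.

Lemma dist_sqr_lt_depth y z x : enclosing_center y z -> Omega x ->
  dotp (x - y) (x - y) < 2 * depth y z x.
Proof.
move=> yz Ox; have := enclosing_center_interior yz Ox.
have := dist_sqr_center x yz.1; rewrite -enorm_sqr.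
have := enorm_ge0 (x - z); nra.
Qed.

Lemma depth_ge0 y z x : enclosing_center y z -> K x -> 0 <= depth y z x.
Proof. by move=> yz Kx; have := dist_sqr_le_depth yz Kx; have := dotp_ge0 (x - y); lra. Qed.

Lemma depth_le y z x : enorm (y - z) = rho -> depth y z x <= rho * enorm (x - y).
Proof. by move=> yz; apply: le_trans (dotp_le _ _) _; rewrite yz enormBC mulrC. Qed.

(** Otherwise the part of the segment inside the domain would be both open and
    closed in the segment. *)
Lemma boundary_crossing a b : Omega a -> ~ Omega b ->
  exists t, [/\ 0 < t, t <= 1 & boundary Omega (a + t *: (b - a))].
Proof.
move=> Oa Ob; apply: contrapT => noT.
pose f (t : R) := a + t *: (b - a).
have cf : continuous f := @continuous_line a (b - a).
have f0 : f 0 = a by rewrite /f scale0r addr0.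
have f1 : f 1 = b by rewrite /f scale1r addrC subrK.
pose B := `[0, 1]%classic `&` f @^-1` Omega.
have BE : B = `[0, 1]%classic.
  apply: (@segment_connected R 0 1).
  - by exists 0; split; rewrite /= ?f0 // in_itv /= lexx ler01.
  - by exists (f @^-1` Omega) => //; apply: open_comp.
  - exists (f @^-1` K); first by apply: closed_comp => //; exact: closed_closure.
    rewrite /B; apply/seteqP; split => t [] /= t01 ft; split => //.
      exact: subset_closure.
    apply: contrapT => nft; apply: noT; exists t.
    move: t01; rewrite in_itv /= => /andP [t0 t1]; split => //.
      rewrite lt_neqAle t0 andbT; apply/eqP => e; apply: nft.
      by rewrite -e f0.
    exact/boundaryP.
apply: Ob; have : B 1 by rewrite BE /= in_itv /= lexx ler01.
by move=> []; rewrite /= f1.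
Qed.

(** A line through an interior point leaves the bounded domain in both
    directions.  Two points make the seminorms on the boundary nonnegative. *)
Lemma boundary_two_points : exists y1 y2,
  [/\ boundary Omega y1, boundary Omega y2 & y1 != y2].
Proof.
have [_ _ [a Oa] [M [_ bM]]] := domO.
pose e : 'rV[R]_n.+1 := delta_mx 0 0.
have e0 : 0 < `|e|.
  by rewrite normr_gt0; apply/eqP => /matrixP /(_ 0 0) /eqP; rewrite !mxE !eqxx oner_eq0.
(* A displacement of this size leaves the ball of radius [|M| + 1] that
   contains the domain. *)
pose N := (`|M| + `|a| + 2) / `|e|.
have N0 : 0 < N by rewrite divr_gt0 //; have := normr_ge0 M; have := normr_ge0 a; lra.
have bO s : `|s| = N -> ~ Omega (a + s *: e).
  move=> sN Os; have /(_ (`|M| + 1)) := bM; have := ler_norm M.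
  move=> hM; rewrite (_ : _ < _); last lra.
  move=> /(_ isT _ Os) /= h.
  have : `|s *: e| <= `|a + s *: e| + `|a|.
    by rewrite -{1}[s *: e](addKr a) addrC (le_trans (ler_normB _ _)).
  have -> : `|s *: e| = `|M| + `|a| + 2 by rewrite normrZ sN divfK // gt_eqF.
  lra.
have [|t [t0 _ bt]] := boundary_crossing Oa (bO N _); first by rewrite gtr0_norm.
have [|s [s0 _ bs]] := boundary_crossing Oa (bO (- N) _).
  by rewrite normrN gtr0_norm.
eexists; eexists; split; [exact: bt | exact: bs |].
rewrite (inj_eq (addrI a)) !(addrC a) !addrK !scalerA.
apply/eqP => /matrixP /(_ 0 0); rewrite !mxE !eqxx !mulr1; nra.
Qed.

(** On a segment from an interior point to [w] the depth at the crossing point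
    is affine, positive at the start and zero at the crossing, hence negative
    at [w].  So the closed domain is an intersection of half-spaces. *)
Lemma outside_halfspace w : ~ K w ->
  exists y z, [/\ boundary Omega y, enclosing_center y z & depth y z w < 0].
Proof.
move=> Kw; have [_ _ [a Oa] _] := domO.
have [|t [t0 t1 bt]] := @boundary_crossing a w Oa.
  by move=> /subset_closure.
set y := a + _ in bt; have [z yz] := sphO bt; exists y, z; split => //.
have := dist_sqr_lt_depth yz Oa; have := dotp_ge0 (a - y).
have := depth_self y z; rewrite {2}/y depth_combination.
have t_lt1 : t < 1.
  rewrite lt_neqAle t1 andbT; apply/eqP => e; apply: Kw.
  by case/boundaryP: bt; rewrite /y e scale1r addrC subrK.
nra.
Qed.

Lemma closure_convex x x' s : K x -> K x' -> 0 <= s <= 1 ->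
  K (x + s *: (x' - x)).
Proof.
move=> Kx Kx' /andP [s0 s1]; apply: contrapT => /outside_halfspace [y [z [_ yz]]].
rewrite depth_combination; have := depth_ge0 yz Kx; have := depth_ge0 yz Kx'; nra.
Qed.

Lemma compact_closure : compact K.
Proof.
apply: bounded_closed_compact; last exact: closed_closure.
have [_ _ _ [M [Mr bM]]] := domO; exists M; split => // N MN x Kx.
suff : closed [set x : 'rV[R]_n.+1 | `|x| <= N].
  by move=> /closure_id ->; move: Kx; apply: closure_subset => x'; exact: bM.
apply: (@closed_comp _ _ (fun x : 'rV[R]_n.+1 => `|x|) [set r | r <= N]).
  by move=> ? _; exact: norm_continuous.
exact: closed_le.
Qed.

(** The variational characterization of the nearest point of a closed convex
    set. *)
Definition is_projection w p := K p /\ forall k, K k -> dotp (w - p) (k - p) <= 0.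

Lemma projection_exists w : exists p, is_projection w p.
Proof.
have K0 : K !=set0 by have [_ _ [a Oa] _] := domO; exists a; exact: subset_closure.
have cd : continuous (fun x => enorm (w - x)).
  apply: continuous_enorm => x.
  by apply: (@continuousB _ _ _ (cst w) id); [exact: cst_continuous | exact: id].
have [p] := compact_EVT_min K0 compact_closure (continuous_subspaceT cd).
rewrite inE => Kp pmin; exists p; split => // k Kk.
rewrite leNgt; apply/negP => wk.
have ineq s : 0 <= s <= 1 -> 2 * s * dotp (w - p) (k - p) <= s ^+ 2 * dotp (k - p) (k - p).
  move=> s01; have := pmin (p + s *: (k - p));
    rewrite inE => /(_ (closure_convex Kp Kk s01)) /=.
  rewrite -[X in is_true X -> _](@ler_pXn2r _ 2) ?nnegrE ?enorm_ge0 // !enorm_sqr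
    opprD addrA.
  move: (w - p) (k - p) => W k'; rewrite !dotpE (dotpC k' W); lra.
have := dotp_ge0 (k - p); move: (dotp (w - p) _) (dotp (k - p) _) wk ineq => W D W0 ineq D0.
have [WD|WD] := leP D W; first by have := ineq 1; rewrite ler01 lexx => /(_ isT); lra.
have D1 : 0 < D by apply: le_lt_trans WD; exact: ltW.
have := ineq (W / D); rewrite divr_ge0 ?(ltW W0) //= ler_pdivrMr // mul1r (ltW WD).
move=> /(_ isT); have -> : (W / D) ^+ 2 * D = W / D * W by field; rewrite gt_eqF.
have : 0 < W / D * W by rewrite !mulr_gt0 ?invr_gt0.
lra.
Qed.

(** Adding the two variational inequalities shows that the projection does not
    increase distances. *)
Lemma projection_dist w w' p p' : is_projection w p -> is_projection w' p' ->
  enorm (p - p') <= enorm (w - w').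
Proof.
move=> [Kp hp] [Kp' hp'].
have h : dotp (p - p') (p - p') <= dotp (w - w') (p - p').
  have := hp _ Kp'; have := hp' _ Kp.
  by rewrite !dotpE !(dotpC p' p); lra.
have := le_trans h (dotp_le _ _); rewrite -enorm_sqr.
have := enorm_ge0 (p - p'); have := enorm_ge0 (w - w'); nra.
Qed.

Lemma projection_id w : K w -> is_projection w w.
Proof. by move=> Kw; split => // k _; rewrite subrr dotp0l. Qed.

(** If the projection were interior, moving it slightly towards [w] would remain
    in the domain and contradict the variational inequality. *)
Lemma projection_boundary w p : ~ Omega w -> is_projection w p -> boundary Omega p.
Proof.
move=> Ow [Kp hp]; apply/boundaryP; split => // Op.
have [t t0 Ot] := open_line (w - p) openO Op.
have := hp _ (subset_closure Ot); rewrite addrAC subrr add0r dotpZr pmulr_rle0 //.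
move=> wp; apply: Ow; suff -> : w = p by [].
by apply/eqP; rewrite -subr_eq0; apply/eqP/dotp_eq0/le_anti; rewrite wp dotp_ge0.
Qed.

End EnclosedDomain.

(** * Variation of differentiable functions along the boundary *)

Section MeanValue.
Variables (R : realType) (m : nat).
Implicit Types (x y z v w : 'rV[R]_m.+1) (G g : 'rV[R]_m.+1 -> R).

(** The library norm is the maximum norm, which the Euclidean norm dominates;
    hence a neighbourhood contains a Euclidean ball. *)
Lemma norm_le_enorm v : `|v| <= enorm v.
Proof.
rewrite [`|v|]mx_normrE; apply: bigmax_le => [|[i j] _ /=]; first exact: enorm_ge0.
rewrite -(@ler_pXn2r _ 2) ?nnegrE ?enorm_ge0 // enorm_sqr real_normK ?num_real //.
rewrite (ord1 i) /dotp (bigD1 j) //= expr2 lerDl sumr_ge0 // => k _.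
by rewrite -expr2 sqr_ge0.
Qed.

Lemma nbhs_enormP x (A : set 'rV[R]_m.+1) : nbhs x A ->
  exists2 d, 0 < d & forall z, enorm (z - x) < d -> A z.
Proof.
move=> /nbhs_ballP [d /= d0 h]; exists d => // z zx; apply: h.
rewrite -ball_normE /ball_ /=; apply: le_lt_trans zx.
by rewrite enormBC norm_le_enorm.
Qed.

(** A bound [M] for the local Lipschitz constant of [G] at [x]; for a
    differentiable [G] this is a bound for the Euclidean norm of the gradient. *)
Definition slope_le G (M : R) x := forall e : R, 0 < e ->
  \forall z \near x, `|G z - G x| <= (M + e) * enorm (z - x).

(** A mean value inequality along a path that is only Lipschitz, so that the
    chain rule is not available.  The bound with a slightly larger constant
    propagates from each parameter to its neighbours, and the supremum of the
    parameters reached is the end of the interval. *)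
Lemma mean_value_path G M (q : R -> 'rV[R]_m.+1) Lq : 0 <= M -> 0 <= Lq ->
  (forall t, 0 <= t <= 1 -> slope_le G M (q t)) ->
  (forall s t, 0 <= s <= 1 -> 0 <= t <= 1 -> enorm (q s - q t) <= Lq * `|s - t|) ->
  `|G (q 1) - G (q 0)| <= M * Lq.
Proof.
move=> M0 L0 sG qL; apply/ler_addgt0Pr => e e0.
pose d := e / (Lq + 1); have d0 : 0 < d by rewrite divr_gt0 //; lra.
suff : `|G (q 1) - G (q 0)| <= (M + d) * Lq.
  move/le_trans; apply; rewrite mulrDl lerD2l /d mulrAC ler_pdivrMr; last lra.
  by rewrite ler_pM2l //; lra.
pose C := (M + d) * Lq; have C0 : 0 <= C by rewrite mulr_ge0 //; lra.
have loc t : 0 <= t <= 1 -> exists2 r, 0 < r &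
    forall s, 0 <= s <= 1 -> `|s - t| < r -> `|G (q s) - G (q t)| <= C * `|s - t|.
  move=> t01; have [r r0 rG] := nbhs_enormP (sG t t01 d d0).
  exists (r / (Lq + 1)); first by rewrite divr_gt0 //; lra.
  move=> s s01 st; have Lst := qL s t s01 t01.
  apply: le_trans (rG _ _) _.
    apply: le_lt_trans Lst _; move: st; rewrite ltr_pdivlMr; last lra.
    by have := normr_ge0 (s - t); nra.
  by rewrite /C -mulrA ler_wpM2l //; lra.
pose B := [set t | 0 <= t <= 1 /\
  forall s, 0 <= s <= t -> `|G (q s) - G (q 0)| <= C * s].
have B0 : B 0.
  split; first by rewrite lexx ler01.
  by move=> s /le_anti <-; rewrite subrr normr0 mulr0.
have supB : has_sup B.
  by split; [exists 0 | exists 1 => t [/andP []]].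
pose c := sup B.
have c0 : 0 <= c by apply: ub_le_sup => //; case: supB.
have c1 : c <= 1 by apply: ge_sup; [exists 0 | move=> t [/andP []]].
have below s : 0 <= s -> s < c -> `|G (q s) - G (q 0)| <= C * s.
  move=> s0 sc; have [t [_ Bt] st] := sup_gt (ex_intro _ 0 B0) sc.
  by apply: Bt; rewrite s0 ltW.
have c01 : 0 <= c <= 1 by rewrite c0 c1.
have [r r0 rG] := loc c c01.
have atc : `|G (q c) - G (q 0)| <= C * c.
  have [->|c_neq0] := eqVneq c 0; first by rewrite subrr normr0 mulr0.
  have c_gt0 : 0 < c by rewrite lt_neqAle eq_sym c_neq0.
  (* A parameter below [c], close enough for the local bound at [c]. *)
  pose s := Num.max 0 (c - r / 2).
  have s0 : 0 <= s by rewrite le_max lexx.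
  have sc : s < c by rewrite gt_max c_gt0 /=; lra.
  have cs : c - r / 2 <= s by rewrite le_max lexx orbT.
  have sc_abs : `|s - c| = c - s by rewrite distrC gtr0_norm //; lra.
  have h := rG s; rewrite sc_abs distrC in h.
  have s01 : 0 <= s <= 1 by rewrite s0 /=; lra.
  have := ler_distD (G (q s)) (G (q c)) (G (q 0)).
  have := below s s0 sc; have := h s01 ltac:(lra); lra.
have near_c s : 0 <= s <= 1 -> s < c + r -> `|G (q s) - G (q 0)| <= C * s.
  move=> /andP [s0 s1] sr; have [sc|cs] := ltP s c; first exact: below.
  have := ler_distD (G (q c)) (G (q s)) (G (q 0)).
  have := rG s; rewrite s0 s1 ger0_norm ?subr_ge0 // => /(_ isT) h.
  have := h ltac:(lra); lra.
suff cE : c = 1.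
  rewrite -[X in _ <= X]mulr1; apply: near_c; first by rewrite ler01 lexx.
  by rewrite cE; lra.
apply/eqP; rewrite eq_le c1 leNgt; apply/negP => clt1.
have [t ct [t1 tr]] : exists2 t, c < t & t <= 1 /\ t < c + r.
  exists (Num.min 1 (c + r / 2)); first by rewrite lt_min clt1 /=; lra.
  by split; [rewrite ge_min lexx | rewrite gt_min; apply/orP; right; lra].
have : t <= c.
  apply: ub_le_sup; first by case: supB.
  split; first by rewrite t1 andbT; lra.
  by move=> s /andP [s0 st]; apply: near_c; [rewrite s0 /=; lra | lra].
lra.
Qed.

Lemma diff_gradE g x v : differentiable g x -> 'd g x v = dotp (grad g x) v.
Proof.
move=> dg; rewrite [in LHS](row_sum_delta v) linear_sum; apply: eq_bigr => i _.
by rewrite linearZ /= mxE deriveE // mulrC.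
Qed.

Lemma slope_le_sub_linear g x (q : 'rV[R]_m.+1) : differentiable g x ->
  slope_le (fun z => g z - dotp q z) (enorm (grad g x - q)) x.
Proof.
move=> dg e e0.
have /eqaddoP /(_ e e0) /nbhs_enormP [d d0 hd] := diff_locally dg.
have := near_enorm_lt x d0; apply: filterS => z zx.
have := hd (z - x); rewrite subr0 => /(_ zx).
rewrite !fctE /= /shift /= subrK diff_gradE // => h.
have -> : g z - dotp q z - (g x - dotp q x) =
    (g z - (g x + dotp (grad g x) (z - x))) + dotp (grad g x - q) (z - x).
  by rewrite !dotpE; ring.
apply: le_trans (ler_normD _ _) _; rewrite mulrDl addrC lerD ?CauchySchwarz_dotp //.
by apply: le_trans h _; rewrite ler_pM2l // norm_le_enorm.
Qed.

End MeanValue.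

Section BoundaryVariation.
Variables (R : realType) (n : nat) (Omega : set 'rV[R]_n.+1) (rho : R).
Hypotheses (domO : bounded_domain Omega) (rho0 : 0 < rho).
Hypothesis sphO : sphere_condition rho Omega.
Implicit Types a b v w x y z p k : 'rV[R]_n.+1.
Local Notation K := (closure Omega).

(** A segment outside the domain projects to a path in the boundary that is at
    most as long, and that stays within distance [r] of [y] because [y] is its
    own projection. *)
Lemma projected_segment (G : 'rV[R]_n.+1 -> R) M y w w' p p' r : 0 <= M ->
  boundary Omega y ->
  (forall t, 0 <= t <= 1 -> ~ Omega (w + t *: (w' - w))) ->
  enorm (w - y) <= r -> enorm (w' - y) <= r ->
  (forall b, boundary Omega b -> enorm (b - y) <= r -> slope_le G M b) ->
  is_projection Omega w p -> is_projection Omega w' p' ->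
  `|G p' - G p| <= M * enorm (w' - w).
Proof.
move=> M0 by_ Ow wr w'r sG wp w'p'.
have [pi piP] := choice (projection_exists domO rho0 sphO).
have piE v v' : is_projection Omega v v' -> pi v = v'.
  move=> vv'; apply/eqP; rewrite -subr_eq0; apply/eqP/enorm_eq0/le_anti.
  by rewrite enorm_ge0 andbT (le_trans (projection_dist (piP v) vv')) // subrr enorm0.
rewrite -(piE _ _ wp) -(piE _ _ w'p').
pose q (t : R) := pi (w + t *: (w' - w)).
have -> : pi w' = q 1 by rewrite /q scale1r addrC subrK.
have -> : pi w = q 0 by rewrite /q scale0r addr0.
apply: mean_value_path => //; first exact: enorm_ge0.
  move=> t t01; apply: sG; first exact: projection_boundary (Ow t t01) (piP _).
  have Ky : K y by case/boundaryP: by_.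
  apply: le_trans (projection_dist (piP _) (projection_id Ky)) _.
  have -> : w + t *: (w' - w) - y = (1 - t) *: (w - y) + t *: (w' - y).
    by apply/rowP => i; rewrite !mxE; ring.
  apply: le_trans (ler_enormD _ _) _; move/andP: t01 => [t0 t1].
  by rewrite !enormZ !ger0_norm ?subr_ge0 //; nra.
move=> s t _ _; apply: le_trans (projection_dist (piP _) (piP _)) _.
rewrite opprD addrACA subrr add0r -scalerBl enormZ mulrC //.
Qed.

Lemma unit_orthogonal (nu mu : 'rV[R]_n.+1) : (0 < n)%N ->
  exists v, [/\ enorm v = 1, dotp v nu = 0 & 0 <= dotp v mu].
Proof.
move=> n0.
have : kermx nu^T != 0.
  rewrite -mxrank_eq0 mxrank_ker -lt0n subn_gt0.
  exact: leq_ltn_trans (rank_leq_col _) _.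
move=> /rowV0Pn [v /sub_kermxP]; rewrite dotp_mulmx => /matrixP /(_ 0 0).
rewrite !mxE eqxx mulr1n => vnu v0.
have ev := enorm_gt0 v0.
pose v1 := (enorm v)^-1 *: v.
have v11 : enorm v1 = 1.
  by rewrite enormZ gtr0_norm ?invr_gt0 // mulVf // gt_eqF.
have v1nu : dotp v1 nu = 0 by rewrite dotpZl vnu mulr0.
have [h|h] := leP 0 (dotp v1 mu); first by exists v1.
by exists (- v1); rewrite enormN !dotpNl v1nu oppr0 oppr_ge0 ltW.
Qed.

(** Two boundary points are joined by a boundary path whose length is comparable
    to the square root of the depth.  From [x] one moves at constant depth, in
    a direction [v] that the enclosing ball at [x] allows, until the distance
    from [y] exceeds what a point of that depth in the domain can have; then
    straight up to the touching hyperplane at [y]; then inside this hyperplane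
    to [y].  The three segments avoid the domain, and the projection carries
    them to the boundary.  In dimension one there is no direction [v], and the
    boundary is disconnected. *)
Lemma boundary_variation (G : 'rV[R]_n.+1 -> R) M x y z :
  (0 < n)%N -> 0 <= M ->
  boundary Omega x -> boundary Omega y -> enclosing_center Omega rho y z ->
  let r := Num.sqrt (2 * depth y z x) in
  (forall b, boundary Omega b -> enorm (b - y) <= 7 * r -> slope_le G M b) ->
  `|G x - G y| <= M * (7 * r).
Proof.
move=> n0 M0 bx by_ yz; set h := depth y z x; move=> r sG.
have [Kx _] := (boundaryP domO x).1 bx; have [Ky _] := (boundaryP domO y).1 by_.
have [zx xzx] := sphO bx.
have h0 : 0 <= h := depth_ge0 yz Kx.
have r0 : 0 <= r := sqrtr_ge0 _.
have rE : r ^+ 2 = 2 * h by rewrite sqr_sqrtr // mulr_ge0.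
have xy : enorm (x - y) <= r.
  by apply: enorm_le => //; rewrite rE; exact: dist_sqr_le_depth yz Kx.
have [v [v1 vnu vmu]] := unit_orthogonal (y - z) (x - zx) n0.
(* [h / rho ^+ 2] is the multiple of [y - z] that brings the depth from [h]
   to [0]. *)
pose p1 := x + (2 * r) *: v; pose c := h / rho ^+ 2; pose p2 := p1 + c *: (y - z).
have yzE : dotp (y - z) (y - z) = rho ^+ 2 by rewrite -enorm_sqr yz.1.
have c0 : 0 <= c by rewrite divr_ge0 // sqr_ge0.
have cE : c * rho ^+ 2 = h by rewrite divfK // sqrf_eq0 gt_eqF.
have l1 : enorm (p1 - x) = 2 * r.
  by rewrite /p1 addrAC subrr add0r enormZ v1 mulr1 ger0_norm ?mulr_ge0.
have l2 : enorm (p2 - p1) <= r.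
  rewrite /p2 addrAC subrr add0r enormZ yz.1 ger0_norm //.
  have := depth_le x yz.1; rewrite -/h -cE => hh; apply: le_trans xy.
  by rewrite -(ler_pM2l rho0); lra.
have p1y : enorm (p1 - y) <= 3 * r by have := ler_enorm_dist x p1 y; lra.
have p2y : enorm (p2 - y) <= 4 * r by have := ler_enorm_dist p1 p2 y; lra.
have d1 : depth y z p1 = h.
  by rewrite /depth /p1 opprD addrA dotpBl dotpZl vnu mulr0 subr0.
have d2 : depth y z p2 = 0.
  by rewrite /depth /p2 opprD addrA dotpBl dotpZl yzE cE -/(depth y z p1) d1 subrr.
have [p1' p1P] := projection_exists domO rho0 sphO p1.
have [p2' p2P] := projection_exists domO rho0 sphO p2.
have s1 : `|G p1' - G x| <= M * enorm (p1 - x).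
  apply: (projected_segment M0 by_ _ _ _ sG (projection_id Kx) p1P); [|lra..].
  move=> t /andP [t0 _] Ow; have := dist_sqr_lt_depth domO rho0 xzx Ow.
  rewrite depth_combination depth_self mulr0 add0r /depth /p1 opprD addNKr.
  rewrite dotpNl dotpZl.
  have := dotp_ge0 (x + t *: (p1 - x) - x).
  have : 0 <= t * (2 * r * dotp v (x - zx)) by rewrite !mulr_ge0.
  rewrite /p1; lra.
have s2 : `|G p2' - G p1'| <= M * enorm (p2 - p1).
  apply: (projected_segment M0 by_ _ _ _ sG p1P p2P); [|lra..].
  move=> t /andP [t0 t1] Ow; have := dist_sqr_lt_depth domO rho0 yz Ow.
  rewrite depth_combination d1 d2 mulr0 addr0; set w := p1 + _ => hw.
  (* The component along [v] already has length at least [r]. *)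
  have wv : r <= dotp (w - y) v.
    have -> : w - y = (x - y) + (2 * r) *: v + (t * c) *: (y - z).
      by apply/rowP => i; rewrite /w /p2 /p1 !mxE; ring.
    rewrite !dotpE (dotpC y v) (dotpC z v) (dotpC x v).
    have := vnu; rewrite dotpBr => vyz.
    have := CauchySchwarz_dotp (x - y) v; rewrite v1 mulr1 ler_norml => /andP [].
    have vv : dotp v v = 1 by rewrite -enorm_sqr v1 expr1n.
    rewrite !dotpE (dotpC x v) (dotpC y v) vv => h1 _.
    have -> : dotp v y = dotp v z by lra.
    lra.
  have := le_trans wv (dotp_le _ _); rewrite v1 mulr1 => rw.
  have : r ^+ 2 <= enorm (w - y) ^+ 2 by rewrite ler_pXn2r ?nnegrE ?enorm_ge0.
  rewrite enorm_sqr rE; nra.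
have s3 : `|G y - G p2'| <= M * enorm (y - p2).
  apply: (projected_segment M0 by_ _ _ _ sG p2P (projection_id Ky)); [|lra|].
    move=> t _ Ow; have := dist_sqr_lt_depth domO rho0 yz Ow.
    rewrite depth_combination d2 depth_self !(mulr0, addr0).
    by rewrite ltNge dotp_ge0.
  by rewrite subrr enorm0; lra.
have t1 := ler_distD (G p1') (G y) (G x); have t2 := ler_distD (G p2') (G y) (G p1').
rewrite (enormBC y) in s3; rewrite distrC.
have : M * enorm (p1 - x) + M * enorm (p2 - p1) + M * enorm (p2 - y) <= M * (7 * r).
  by rewrite -!mulrDr ler_wpM2l //; lra.
lra.
Qed.

End BoundaryVariation.

(** * Powers: tangents and second-order expansions *)

Section PowerCalculus.
Variable R : realType.
Implicit Types s t r d e th gam : R.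

(** Concavity of the power: after scaling to [t = 1] it is the weighted
    arithmetic-geometric mean inequality, which follows from
    [1 + w <= expR w] applied to [w - th * w] and to [- th * w]. *)
Lemma powR_tangent s t th : 0 <= s -> 0 < t -> 0 < th <= 1 ->
  s `^ th <= t `^ th + th * t `^ (th - 1) * (s - t).
Proof.
move=> s0 t0 /andP [th0 th1].
have tE : t `^ (th - 1) = t `^ th / t.
  by rewrite powRB ?powRr1 ?(ltW t0) // (gt_eqF t0) implybT.
have -> : t `^ th + th * t `^ (th - 1) * (s - t) = t `^ th * (1 - th + th * (s / t)).
  by rewrite tE; field; rewrite gt_eqF.
have [->|s_neq0] := eqVneq s 0.
  by rewrite powR0 ?gt_eqF // mul0r mulr0 addr0 mulr_ge0 ?powR_ge0 // subr_ge0.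
have sp : 0 < s by rewrite lt_neqAle eq_sym s_neq0.
have -> : s `^ th = t `^ th * (s / t) `^ th.
  rewrite -powRM ?divr_ge0 ?(ltW t0) //; congr (_ `^ _).
  by rewrite mulrC divfK // gt_eqF.
rewrite ler_pM2l ?powR_gt0 //.
have st : 0 < s / t by rewrite divr_gt0.
have stE : s / t = expR (ln (s / t)) by rewrite lnK.
rewrite /powR gt_eqF //; set w := ln (s / t) in stE *; rewrite stE.
set a := th * w.
have h1 : expR a * (1 + (w - a)) <= expR w.
  by rewrite -{2}(subrKC a w) expRD ler_pM2l ?expR_gt0 // expR_ge1Dx.
have h2 : expR a * (1 - a) <= 1.
  by rewrite -{2}(expRxMexpNx_1 a) ler_pM2l ?expR_gt0 // expR_ge1Dx.
have h1' := ler_wpM2l (ltW th0) h1.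
have h2' : (1 - th) * (expR a * (1 - a)) <= (1 - th) * 1 by rewrite ler_wpM2l ?subr_ge0.
have : expR a = th * (expR a * (1 + (w - a))) + (1 - th) * (expR a * (1 - a)).
  by rewrite /a; ring.
lra.
Qed.

(** On bounded distances a smaller exponent gives, up to a constant, the larger
    power; this brings all error terms to the exponent [gam]. *)
Lemma powR_compare r d gam th : 0 <= r <= d -> 1 <= d ->
  0 <= gam <= th -> 0 < th <= 2 -> r `^ th <= d ^+ 2 * r `^ gam.
Proof.
move=> /andP [r0 rd] d1 /andP [g0 gth] /andP [th0 th2].
have [->|r_neq0] := eqVneq r 0.
  by rewrite powR0 ?gt_eqF // mulr_ge0 ?powR_ge0 // sqr_ge0.
rewrite -(subrK gam th) powRD ?r_neq0 ?implybT //.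
apply: ler_wpM2r; first exact: powR_ge0.
apply: le_trans (_ : d `^ (th - gam) <= _).
  by apply: ge0_ler_powR; rewrite ?nnegrE ?subr_ge0 //; lra.
by rewrite -powR_mulrn; [apply: ler_powR => //; lra | lra].
Qed.

Lemma is_derive_expansion (f : R -> R) s l e : is_derive s 1 f l -> 0 < e ->
  exists2 d, 0 < d & forall t, `|t - s| < d ->
    `|f t - f s - l * (t - s)| <= e * `|t - s|.
Proof.
move=> [df fl] e0; have dif : differentiable f s by exact/derivable1_diffP.
have /eqaddoP /(_ e e0) /nbhs_ballP [d /= d0 hd] := diff_locally dif.
exists d => // t ts; have := hd (t - s); rewrite /ball /= sub0r normrN => /(_ ts).
rewrite !fctE /= /shift /= subrK opprD addrA.
suff -> : 'd f s (t - s) = l * (t - s) by [].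
by rewrite -fl deriveE // -[t - s in LHS]mulr1 -['d f s (_ * _)]/('d f s ((t - s)
  *: 1)) linearZ mulrC.
Qed.

(** The mean value theorem for [f] minus its second-order Taylor polynomial,
    whose derivative is the first-order error of [f']. *)
Lemma second_order_expansion (f f' : R -> R) s l r e : 0 < r -> 0 < e ->
  (forall t, `|t - s| < r -> is_derive t 1 f (f' t)) -> is_derive s 1 f' l ->
  exists2 d, 0 < d & forall t, `|t - s| < d ->
    f t <= f s + f' s * (t - s) + l / 2 * (t - s) ^+ 2 + e * (t - s) ^+ 2.
Proof.
move=> r0 e0 df df'; have [d d0 hd] := is_derive_expansion df' e0.
exists (Num.min r d) => [|t]; first by rewrite lt_min r0.
rewrite lt_min => /andP [tr td].
pose g x := f x - (f' s * (x - s) + l / 2 * (x - s) ^+ 2).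
pose g' x := f' x - (f' s + l * (x - s)).
have dg x : `|x - s| < r -> is_derive x 1 g (g' x).
  move=> /df dx; rewrite /g; apply: is_derive_eq.
  by rewrite /g' /GRing.scale /=; field.
have gE : g t - g s = f t - (f s + f' s * (t - s) + l / 2 * (t - s) ^+ 2).
  by rewrite /g; ring.
have g'le x : `|x - s| <= `|t - s| -> `|g' x| <= e * `|t - s|.
  move=> xt; have := hd x (le_lt_trans xt td); rewrite /g' opprD addrA => h.
  by apply: le_trans h _; rewrite ler_pM2l.
suff [c cs cE] : exists2 c, `|c - s| <= `|t - s| & g t - g s = g' c * (t - s).
  have : g t - g s <= e * (t - s) ^+ 2.
    apply: le_trans (ler_norm _) _; rewrite cE normrM -(real_normK (num_real (t - s))).
    by rewrite expr2 mulrA ler_wpM2r // g'le.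
  by rewrite gE; lra.
have cont a b : (forall x, x \in `[a, b] -> `|x - s| < r) -> {within `[a, b], continuous g}.
  move=> h; apply: derivable_within_continuous => x /h /dg dx.
  exact: ex_derive.
have [ts|st] := leP t s.
  have [||c] := @MVT_segment R g g' t s ts.
  - by move=> x; rewrite in_itv /= => /andP [x1 x2]; apply: dg;
    apply: le_lt_trans tr; rewrite !ler0_norm; lra.
  - apply: cont => x; rewrite in_itv /= => /andP [x1 x2].
    by apply: le_lt_trans tr; rewrite !ler0_norm; lra.
  rewrite in_itv /= => /andP [c1 c2] cE; exists c; first by rewrite !ler0_norm; lra.
  by rewrite -(opprB s t) mulrN -cE; ring.
have [||c] := @MVT_segment R g g' s t (ltW st).
- by move=> x; rewrite in_itv /= => /andP [x1 x2]; apply: dg;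
  apply: le_lt_trans tr; rewrite !ger0_norm; lra.
- apply: cont => x; rewrite in_itv /= => /andP [x1 x2].
  by apply: le_lt_trans tr; rewrite !ger0_norm; lra.
by rewrite in_itv /= => /andP [c1 c2] cE; exists c => //; rewrite !ger0_norm; lra.
Qed.

End PowerCalculus.

(** * Barriers and comparison *)

Section Barriers.
Variables (R : realType) (n : nat).
Implicit Types (u phi : 'rV[R]_n.+1 -> R) (x y z xi : 'rV[R]_n.+1).

Lemma taylor2_rank1 u x xi c q p y : taylor2 u x xi (rank1 c q p) y =
  u x + dotp xi (y - x) +
  2^-1 * (c * dotp (y - x) (y - x) + q * dotp (y - x) p ^+ 2).
Proof.
rewrite /taylor2; move: (y - x) => v.
by rewrite mul_rank1 dotpDl !dotpZl (dotpC p); ring.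
Qed.

Lemma super_jet_touching u phi Omega x xi X : open Omega -> Omega x ->
  (forall y, Omega y -> u y - phi y <= u x - phi x) ->
  super_jet phi x xi X -> super_jet u x xi X.
Proof.
move=> oO Ox umax jet e e0; apply: filterS2 (open_nbhs_nbhs (conj oO Ox)) (jet e e0).
by move=> y Oy; have := umax y Oy; rewrite /taylor2; lra.
Qed.

(** Second-order expansion of a radial function [f(|x - y|^2)]: the increment of
    [|x - y|^2] is [2 <x - y, h> + |h|^2], so the Hessian is [2 f' I] plus the
    rank-one matrix [4 f''] along [x - y]. *)
Lemma super_jet_radial (f f' : R -> R) (l r : R) y x :
  let s := dotp (x - y) (x - y) in
  0 < r -> (forall t, `|t - s| < r -> is_derive t 1 f (f' t)) ->
  is_derive s 1 f' l ->
  super_jet (fun x => f (dotp (x - y) (x - y))) x ((2 * f' s) *: (x - y))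
    (rank1 (2 * f' s) (4 * l) (x - y)).
Proof.
move=> s r0 df df' e e0.
pose P := enorm (x - y); have P0 : 0 <= P := enorm_ge0 _.
pose P1 := 2 * P + 1; have P1_gt0 : 0 < P1 by rewrite /P1; lra.
have e1_gt0 : 0 < e / (2 * P1 ^+ 2) by rewrite divr_gt0 // mulr_gt0 // exprn_gt0.
have [d d0 hd] := second_order_expansion r0 e1_gt0 df df'.
pose Q := `|l| * (4 * P + 1) + 1; have Q_gt0 : 0 < Q.
  by rewrite /Q; have := normr_ge0 l; nra.
(* [P1] and [Q] bound the two error terms: the one-dimensional expansion, and
   the part of the squared increment that is of third order in [h]. *)
pose eta := Num.min 1 (Num.min (d / P1) (e / Q)).
have eta0 : 0 < eta by rewrite !lt_min ltr01 !divr_gt0.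
have := near_enorm_lt x eta0; apply: filterS => z.
rewrite !lt_min !ltr_pdivlMr // => /and3P []; rewrite taylor2_rank1.
set h := z - x; set H := enorm h => H1 Hd He.
have H0 : 0 <= H := enorm_ge0 _.
have Hsq : dotp h h = H ^+ 2 by rewrite enorm_sqr.
pose w := dotp h (x - y).
have wle : `|w| <= H * P := CauchySchwarz_dotp _ _.
have tE : dotp (z - y) (z - y) - s = 2 * w + H ^+ 2.
  have -> : z - y = (x - y) + h by rewrite /h [RHS]addrC subrKA.
  by rewrite -Hsq dotp_sqrD /s /w; ring.
set t := dotp (z - y) _ in tE *.
have tle : `|t - s| <= P1 * H.
  rewrite tE; apply: le_trans (ler_normD _ _) _.
  rewrite normrM (@gtr0_norm _ 2) // (ger0_norm (sqr_ge0 H)) /P1; nra.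
have tsd : `|t - s| < d by apply: le_lt_trans tle _; rewrite mulrC.
apply: le_trans (hd t tsd) _.
rewrite dotpZl (dotpC _ h) -/w Hsq tE.
have errQ : l / 2 * (4 * w * H ^+ 2 + H ^+ 2 * H ^+ 2) <= e / 2 * H ^+ 2.
  have -> : l / 2 * (4 * w * H ^+ 2 + H ^+ 2 * H ^+ 2) =
    (l * (4 * w + H ^+ 2)) / 2 * H ^+ 2 by ring.
  rewrite ler_wpM2r ?sqr_ge0 // ler_pM2r ?invr_gt0 //.
  apply: le_trans (ler_norm _) _; rewrite normrM; apply: le_trans (ltW He).
  apply: (@le_trans _ _ (`|l| * ((4 * P + 1) * H))).
    apply: ler_wpM2l => //; apply: le_trans (ler_normD _ _) _.
    rewrite normrM (@gtr0_norm _ 4) // (ger0_norm (sqr_ge0 H)); nra.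
  by rewrite /Q; nra.
have errP : e / (2 * P1 ^+ 2) * (2 * w + H ^+ 2) ^+ 2 <= e / 2 * H ^+ 2.
  have : (2 * w + H ^+ 2) ^+ 2 <= (P1 * H) ^+ 2.
    rewrite -tE -(real_normK (num_real (t - s))) ler_pXn2r ?nnegrE //.
    by rewrite mulr_ge0 // ltW.
  move=> /(ler_wpM2l (ltW e1_gt0)) /le_trans; apply.
  rewrite le_eqVlt; apply/orP; left; apply/eqP; field.
  by rewrite gt_eqF.
rewrite -/s; lra.
Qed.

(** The only consequence of the equation that the barriers use.  It holds for
    [u] with the operator itself and for [- u] with the dual operator, so that
    each estimate below is proved once and serves both. *)
Definition subsolution_bound (F : 'M[R]_n.+1 -> R) (k : R) Omega u :=
  forall x xi X, Omega x -> X^T = X -> super_jet u x xi X -> - k <= F X.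

(** The only property of the operator that the barriers use; [A] stands for the
    total weight and [a1] for the weight of the smallest eigenvalue. *)
Definition rank1_bound (F : 'M[R]_n.+1 -> R) (A a1 : R) := forall c q p, q <= 0 ->
  F (rank1 c q p) <= A * c + a1 * (q * dotp p p).

End Barriers.

Section Comparison.
Variables (R : realType) (n : nat) (Omega : set 'rV[R]_n.+1) (rho : R).
Hypotheses (domO : bounded_domain Omega) (rho0 : 0 < rho).
Hypothesis sphO : sphere_condition rho Omega.
Implicit Types x y z b : 'rV[R]_n.+1.
Local Notation K := (closure Omega).
Variables (F : 'M[R]_n.+1 -> R) (k A a1 B : R) (u : 'rV[R]_n.+1 -> R).
Hypotheses (subu : subsolution_bound F k Omega u) (boundF : rank1_bound F A a1).
Hypotheses (cu : {within K, continuous u}) (BA : k < 2 * A * B).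

(** At an interior maximum of [u - phi] the jet of [phi] is a test jet of [u], and
    a strict supersolution contradicts the subsolution inequality.  The
    alternative [u x <= phi x] accommodates the vertex of a cone, where [phi]
    has no second-order jet. *)
Lemma comparison phi : {within K, continuous phi} ->
  (forall x, Omega x -> exists xi c q p,
    [\/ u x <= phi x | [/\ super_jet phi x xi (rank1 c q p), q <= 0 &
       A * c + a1 * (q * dotp p p) < - k]]) ->
  (forall x, boundary Omega x -> u x <= phi x) ->
  forall x, K x -> u x <= phi x.
Proof.
move=> cphi inner bnd.
have K0 : K !=set0 by have [_ _ [a Oa] _] := domO; exists a; exact: subset_closure.
have cw : {within K, continuous (fun x => u x - phi x)}.
  by move=> x; apply: cvgB; [exact: cu | exact: cphi].
have [x0] := compact_EVT_max K0 (compact_closure domO) cw.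
rewrite inE => Kx0 xmax.
have xmax' x : K x -> u x - phi x <= u x0 - phi x0 by move=> Kx; apply: xmax; rewrite inE.
suff h : u x0 <= phi x0 by move=> x /xmax'; lra.
have [Ox0|nOx0] := pselect (Omega x0); last first.
  by apply: bnd; apply/(boundaryP domO).
have [xi [c [q [p [//|[jet q0 cq]]]]]] := inner _ Ox0.
have oO : open Omega by case: domO.
have jetu : super_jet u x0 xi (rank1 c q p).
  apply: super_jet_touching oO Ox0 _ jet => y Oy.
  exact: xmax' (subset_closure Oy).
have := subu Ox0 (rank1_sym c q p) jetu; have := boundF c p q0; lra.
Qed.

(** A quadratic function with Hessian [- 2 B I] is a strict supersolution as soon
    as [2 A B] exceeds the bound of the right-hand side. *)
Lemma quadratic_comparison phi (xi : 'rV[R]_n.+1 -> 'rV[R]_n.+1) :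
  (forall x y, phi y = phi x + dotp (xi x) (y - x) - B * dotp (y - x) (y - x)) ->
  (forall x, boundary Omega x -> u x <= phi x) ->
  forall x, K x -> u x <= phi x.
Proof.
move=> phiE; apply: comparison.
  apply: continuous_subspaceT.
  have -> : phi = fun y => phi 0 + dotp (xi 0) y - B * dotp y y.
    by apply/funext => y; rewrite (phiE 0 y) subr0.
  have cid : continuous (fun y : 'rV[R]_n.+1 => y) by move=> y; exact: cvg_id.
  have ccst : continuous (fun y : 'rV[R]_n.+1 => xi 0) by exact: cst_continuous.
  have c1 := continuous_dotp ccst cid; have c2 := continuous_dotp cid cid.
  move=> y.
  apply: (@continuousB _ _ _ (fun y => phi 0 + dotp (xi 0) y) (fun y => B * dotp y y)).
    by apply: (@continuousD _ _ _ (cst (phi 0))); [exact: cst_continuous | exact: c1].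
  by apply: (@continuousM _ _ (cst B)); [exact: cst_continuous | exact: c2].
move=> x Ox; exists (xi x), (- (2 * B)), 0, 0; right; split => //.
  move=> e e0; near=> y; rewrite taylor2_rank1 (phiE x y).
  have : 0 <= e * enorm (y - x) ^+ 2 by rewrite mulr_ge0 ?sqr_ge0 // ltW.
  lra.
by rewrite mul0r mulr0 addr0 mulrN ltrN2 mulrCA mulrA.
Unshelve. all: by end_near. Qed.

(** At a given point [x] the concave power of the depth is replaced by its tangent
    at the depth of [x]: this only increases the boundary values and changes
    nothing at [x].  The resulting barrier is affine, up to the multiple [B] of
    [2 depth - |. - y|^2], which is nonnegative on the closed domain and has
    Hessian [- 2 I]. *)
Lemma boundary_estimate y z (q : 'rV[R]_n.+1) H th :
  boundary Omega y -> enclosing_center Omega rho y z -> 0 <= B -> 0 <= H -> 0 < th <= 1 ->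
  (forall x, boundary Omega x ->
    u x <= u y + dotp q (x - y) + H * (2 * depth y z x) `^ th) ->
  forall x, K x ->
    u x <= u y + dotp q (x - y) + H * (2 * depth y z x) `^ th + B * (2 * depth y z x).
Proof.
move=> by_ yz B0 H0 th01 bnd x Kx.
have /andP [th0 th1] := th01.
have dx := dist_sqr_le_depth yz Kx.
have d2 := dotp_ge0 (x - y).
have [xy|xy] := eqVneq x y.
  rewrite xy depth_self mulr0 powR0 ?gt_eqF // subrr.
  by rewrite dotpC dotp0l; lra.
set t := 2 * depth y z x in dx *.
have t0 : 0 < t.
  by apply: lt_le_trans dx; rewrite -enorm_sqr exprn_gt0 // enorm_gt0 // subr_eq0.
(* [m] is the slope of the tangent at [t]. *)
pose m := th * t `^ (th - 1).
have m0 : 0 <= m by rewrite mulr_ge0 ?powR_ge0 // ltW.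
pose phi w := u y + dotp q (w - y) + H * (t `^ th + m * (2 * depth y z w - t)) +
  B * (2 * depth y z w - dotp (w - y) (w - y)).
pose xi w := q - (2 * (H * m + B)) *: (y - z) - (2 * B) *: (w - y).
have phiE w w' : phi w' = phi w + dotp (xi w) (w' - w) - B * dotp (w' - w) (w' - w).
  have -> : w' = w + (w' - w) by rewrite addrC subrK.
  move: (w' - w) => v; rewrite /phi /xi /depth (addrC w v) addrK.
  rewrite !dotpE !(dotpC v) ; ring.
have := @quadratic_comparison phi xi phiE _ x Kx.
rewrite {2}/phi -/t subrr mulr0 addr0 => h.
apply: le_trans (h _) _.
  move=> w bw; apply: le_trans (bnd w bw) _.
  have [Kw _] := (boundaryP domO w).1 bw.
  have dw := dist_sqr_le_depth yz Kw.
  have dw0 : 0 <= 2 * depth y z w by rewrite mulr_ge0 // (depth_ge0 yz Kw).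
  apply: ler_wpDr; first by rewrite mulr_ge0 ?subr_ge0.
  by rewrite lerD2l ler_wpM2l //; exact: powR_tangent.
rewrite lerD2l ler_wpM2l // /t; lra.
Qed.

End Comparison.

(** * From the boundary to the interior *)

Section InteriorEstimate.
Variables (R : realType) (n : nat) (Omega : set 'rV[R]_n.+1) (rho : R).
Hypotheses (domO : bounded_domain Omega) (rho0 : 0 < rho).
Hypothesis sphO : sphere_condition rho Omega.
Implicit Types x y z b : 'rV[R]_n.+1.
Local Notation K := (closure Omega).

Lemma enorm_powR x y (gam : R) :
  enorm (x - y) `^ gam = dotp (x - y) (x - y) `^ (gam / 2).
Proof.
rewrite -enorm_sqr -(powR_mulrn 2 (enorm_ge0 _)) -powRrM.
by rewrite mulrCA divff ?mulr1.
Qed.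

Lemma continuous_dist_powR y (gam : R) : 0 < gam ->
  continuous (fun x => enorm (x - y) `^ gam).
Proof.
move=> g0 x.
have cd : continuous (fun x : 'rV[R]_n.+1 => enorm (x - y)).
  apply: continuous_enorm => t.
  by apply: (@continuousB _ _ _ id (cst y)); [exact: id | exact: cst_continuous].
have [->|xy] := eqVneq x y; last first.
  have d0 : 0 < enorm (x - y) by rewrite enorm_gt0 // subr_eq0.
  have cp : {for enorm (x - y), continuous (@powR R ^~ gam)}.
    apply: differentiable_continuous; apply/derivable1_diffP.
    exact: (@ex_derive _ _ _ _ _ _ _ (is_derive1_powR gam d0)).
  exact: (continuous_comp (cd x) cp).
rewrite /continuous_at subrr enorm0 powR0 ?gt_eqF //.
apply: (proj2 (@cvgrPdist_lt _ _ _ (nbhs y) _ _ _)) => e e0.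
have r0 : 0 < e `^ gam^-1 by rewrite powR_gt0.
have := near_enorm_lt y r0; apply: filterS => t ty.
rewrite sub0r normrN ger0_norm ?powR_ge0 //.
have := gt0_ltr_powR g0 (enorm_ge0 (t - y)) (powR_ge0 _ _) ty.
by rewrite -powRrM mulVf ?gt_eqF // powRr1 // ltW.
Qed.

Lemma diameter_le x y : K x -> K y -> enorm (x - y) <= 2 * rho.
Proof.
move=> Kx Ky; have [b [_ [bb _ _]]] := boundary_two_points domO.
have [z [_ Kz]] := sphO bb; have /= xz := Kz x Kx; have /= yz := Kz y Ky.
have := ler_enorm_dist z x y; rewrite (enormBC z); lra.
Qed.

Variables (F : 'M[R]_n.+1 -> R) (k A a1 B : R) (u : 'rV[R]_n.+1 -> R).
Hypotheses (subu : subsolution_bound F k Omega u) (boundF : rank1_bound F A a1).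
Hypotheses (cu : {within K, continuous u}) (BA : k < 2 * A * B).

(** The cone [A' |x - y|^gam] has the radial eigenvalue
    [A' gam (gam - 1) r^(gam - 2)] and all others equal to
    [A' gam r^(gam - 2)].  The radial one is the smallest and receives the
    weight [a1], so the operator is nonpositive on the cone exactly under
    [A - a1 <= (1 - gam) a1]; the term [- B |x - y|^2] makes it strict. *)
Lemma interior_estimate y (gam A' : R) : 0 < gam <= 1 -> 0 <= A' ->
  A - a1 <= (1 - gam) * a1 ->
  (forall x, boundary Omega x ->
     u x <= u y + A' * enorm (x - y) `^ gam - B * dotp (x - y) (x - y)) ->
  forall x, K x -> u x <= u y + A' * enorm (x - y) `^ gam - B * dotp (x - y) (x - y).
Proof.
move=> /andP [g0 g1] A'0 hat; apply: (comparison domO subu boundF cu).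
  apply: continuous_subspaceT => x.
  have cid : continuous (fun x : 'rV[R]_n.+1 => x - y).
    move=> t; apply: (@continuousB _ _ _ id (cst y)); [exact: id | exact: cst_continuous].
  have c2 := continuous_dotp cid cid.
  apply: (@continuousB _ _ _ (fun x => u y + A' * enorm (x - y) `^ gam)
    (fun x => B * dotp (x - y) (x - y))); last first.
    by apply: (@continuousM _ _ (cst B)); [exact: cst_continuous | exact: c2].
  apply: (@continuousD _ _ _ (cst (u y)) (fun x => A' * enorm (x - y) `^ gam)).
    exact: cst_continuous.
  apply: (@continuousM _ _ (cst A')); first exact: cst_continuous.
  exact: continuous_dist_powR.
move=> x Ox; pose ka := gam / 2; pose s := dotp (x - y) (x - y).
pose f t := u y + A' * t `^ ka - B * t; pose f' t := A' * (ka * t `^ (ka - 1)) - B.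
pose l := A' * (ka * ((ka - 1) * s `^ (ka - 1 - 1))).
exists ((2 * f' s) *: (x - y)), (2 * f' s), (4 * l), (x - y).
have [->|xy] := eqVneq x y.
  left; rewrite subrr enorm0 powR0 ?gt_eqF // dotp0l; lra.
have s0 : 0 < s by rewrite /s -enorm_sqr exprn_gt0 // enorm_gt0 // subr_eq0.
have ka0 : 0 < ka by rewrite divr_gt0.
have ka1 : ka - 1 <= 0 by rewrite /ka; lra.
right; split.
- have -> : (fun x => u y + A' * enorm (x - y) `^ gam - B * dotp (x - y) (x - y)) =
      fun x => f (dotp (x - y) (x - y)).
    by apply/funext => w; rewrite /f enorm_powR.
  apply: (super_jet_radial s0) => [t ts|].
    have t0 : 0 < t by move: ts; rewrite ltr_norml => /andP [] + _; rewrite -/s; lra.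
    have := is_derive1_powR ka t0 => dt.
    by rewrite /f /f'; apply: is_derive_eq; rewrite /GRing.scale /=; ring.
  have := is_derive1_powR (ka - 1) s0 => ds.
  by rewrite /f' /l; apply: is_derive_eq; rewrite /GRing.scale /=; ring.
- have : l <= 0; last lra.
  by rewrite /l mulr_ge0_le0 // mulr_ge0_le0 ?(ltW ka0) // mulr_le0_ge0 ?powR_ge0.
have sE : s `^ (ka - 1 - 1) * s = s `^ (ka - 1).
  by rewrite -{2}(powRr1 (ltW s0)) -powRD ?subrK // (gt_eqF s0) implybT.
have -> : A * (2 * f' s) + a1 * (4 * l * dotp (x - y) (x - y)) =
    2 * (A' * ka * s `^ (ka - 1)) * (A - a1 - (1 - gam) * a1) - 2 * A * B.
  by rewrite -/s /f' /l -sE /ka; field.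
have m0 : 0 <= A' * ka * s `^ (ka - 1) by rewrite !mulr_ge0 ?powR_ge0 // ltW.
apply: (@le_lt_trans _ _ (- (2 * A * B))); last by rewrite ltrN2.
rewrite gerDr; apply: mulr_ge0_le0; last by rewrite subr_le0.
exact: (mulr_ge0 (ler0n R 2) m0).
Qed.

(** Cones with vertex at an interior point [y] lie above [u] on the boundary by the
    boundary estimate, hence everywhere; exchanging the two points gives the
    absolute value.  The exponent [0] is separate: there the cone is constant,
    and one passes through a boundary point. *)
Lemma holder_closure (gam M : R) : 0 <= gam <= 1 -> 0 <= M -> 0 <= B ->
  A - a1 <= (1 - gam) * a1 ->
  (forall x b, K x -> boundary Omega b -> `|u x - u b| <= M * enorm (x - b) `^ gam) ->
  forall x y, K x -> K y ->
    `|u x - u y| <= (2 * M + B * (1 + 2 * rho) ^+ 2) * enorm (x - y) `^ gam.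
Proof.
move=> /andP [g0 g1] M0 B0 hat bnd.
have d1 : 1 <= 1 + 2 * rho by rewrite lerDl mulr_ge0 // ltW.
have : 2 * rho <= 1 + 2 * rho by lra.
move: (1 + 2 * rho) d1 => d d1 rhod.
have D0 : 0 <= B * d ^+ 2 by rewrite mulr_ge0 // sqr_ge0.
have [gE|g_neq0] := eqVneq gam 0.
  move=> x y Kx Ky; rewrite gE powRr0 mulr1.
  have [b [_ [bb _ _]]] := boundary_two_points domO.
  have := bnd x b Kx bb; have := bnd y b Ky bb; rewrite gE !powRr0 !mulr1 => h1 h2.
  have := ler_distD (u b) (u x) (u y); rewrite (distrC (u b)); lra.
have gp : 0 < gam by rewrite lt_neqAle eq_sym g_neq0.
suff half x y : K x -> K y -> u x - u y <= (2 * M + B * d ^+ 2) * enorm (x - y) `^ gam.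
  move=> x y Kx Ky; rewrite ler_norml half // andbT lerNl opprB enormBC.
  exact: half.
move=> Kx Ky; have P0 := powR_ge0 (enorm (x - y)) gam.
have weaken : (M + B * d ^+ 2) * enorm (x - y) `^ gam <= (2 * M + B * d ^+ 2) *
  enorm (x - y) `^ gam.
  by apply: ler_wpM2r => //; lra.
have [Oy|nOy] := pselect (Omega y); last first.
  have by_ : boundary Omega y by apply/(boundaryP domO).
  apply: le_trans (ler_norm _) _; apply: le_trans (bnd x y Kx by_) _.
  by apply: le_trans weaken; apply: ler_wpM2r => //; lra.
have := @interior_estimate y gam (M + B * d ^+ 2) _ _ hat _ x Kx.
rewrite gp g1 addr_ge0 // => /(_ isT isT) h.
have {h} : u x <= u y + (M + B * d ^+ 2) * enorm (x - y) `^ gam -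
    B * dotp (x - y) (x - y).
  apply: h => b bb; have [Kb _] := (boundaryP domO b).1 bb.
  have := bnd y b Ky bb; rewrite distrC enormBC => /(le_trans (ler_norm _)) h1.
  have : dotp (b - y) (b - y) <= d ^+ 2 * enorm (b - y) `^ gam.
    rewrite -enorm_sqr -(powR_mulrn 2 (enorm_ge0 _)); apply: powR_compare => //.
    - by rewrite enorm_ge0 (le_trans (diameter_le Kb Ky)).
    - by rewrite g0; lra.
    - by rewrite ltr0n lexx.
  move=> /(ler_wpM2l B0); lra.
have : 0 <= B * dotp (x - y) (x - y) by rewrite mulr_ge0 ?dotp_ge0.
lra.
Qed.

End InteriorEstimate.

(** * The dominant weight and the Hoelder estimate with quantitative data *)

Section Weights.
Variables (R : realType) (n : nat) (a : 'I_n.+1 -> R).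
Hypothesis wa : weights a.

Lemma wsum_gt0 : 0 < wsum a.
Proof.
have [a0 [j aj]] := wa; rewrite /wsum (bigD1 j) //=.
by apply: ltr_wpDr => //; apply: sumr_ge0 => i _; exact: a0.
Qed.

(** Dominance of an extreme weight forces it to be positive, so the maximum is
    taken over at least one finite nonnegative term. *)
Lemma alpha_attained : what a ord0 <= a ord0 \/ what a ord_max <= a ord_max ->
  0 <= alpha a /\
  exists2 j, j \in [:: ord0; ord_max] & 0 < a j /\ alpha a = 1 - what a j / a j.
Proof.
have [a0 _] := wa => dom.
have term j : alpha_term a j = -oo%E \/ 0 < a j /\ alpha_term a j = (1 - what a j / a j)%:E.
  rewrite /alpha_term; case: eqVneq => [_|aj]; [by left | right; split => //].
  by rewrite lt_neqAle eq_sym aj a0.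
have ge0 j : what a j <= a j -> 0 < a j /\ 0 <= 1 - what a j / a j.
  move=> wj; have aj : 0 < a j.
    rewrite lt_neqAle a0 andbT; apply/eqP => aj; move: wj.
    by rewrite /what -aj subr0 leNgt wsum_gt0.
  by split => //; rewrite subr_ge0 ler_pdivrMr // mul1r.
rewrite /alpha.
case: (term ord0) => [e0|[p0 e0]]; case: (term ord_max) => [e1|[p1 e1]].
- case: dom => /ge0 [aj _].
    by move: e0; rewrite /alpha_term gt_eqF.
  by move: e1; rewrite /alpha_term gt_eqF.
- rewrite e0 e1 maxNye /=; split; last by exists ord_max => //; rewrite !inE eqxx orbT.
  case: dom => /ge0 [aj //].
  by move: e0; rewrite /alpha_term gt_eqF.
- rewrite e0 e1 maxeNy /=; split; last by exists ord0 => //; rewrite !inE eqxx.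
  case: dom => /ge0 [aj //].
  by move: e1; rewrite /alpha_term gt_eqF.
rewrite e0 e1 -EFin_max /=; split.
  by case: dom => /ge0 [_ h]; rewrite le_max h ?orbT.
rewrite /Num.max; case: ifP => _.
  by exists ord_max => //; rewrite !inE eqxx orbT.
by exists ord0 => //; rewrite !inE eqxx.
Qed.

Lemma dominant_weight gam :
  what a ord0 <= a ord0 \/ what a ord_max <= a ord_max -> gam <= alpha a ->
  what a ord0 <= (1 - gam) * a ord0 \/ what a ord_max <= (1 - gam) * a ord_max.
Proof.
move=> /alpha_attained [_ [j jin [aj ->]]] gle.
have h : what a j <= (1 - gam) * a j.
  by rewrite -ler_pdivrMr //; lra.
by move: jin h; rewrite !inE => /orP [] /eqP -> h; [left | right].
Qed.

End Weights.

Section GlobalEstimate.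
Variables (R : realType) (n : nat) (Omega : set 'rV[R]_n.+1) (rho : R).
Hypotheses (domO : bounded_domain Omega) (rho0 : 0 < rho).
Hypothesis sphO : sphere_condition rho Omega.
Implicit Types x y z b : 'rV[R]_n.+1.
Local Notation K := (closure Omega).
Local Notation d := (1 + 2 * rho).

(** The barrier estimate with all terms brought to the exponent [gam]; the depth
    is at most [rho |x - y|], which is where the exponent of the data is
    halved. *)
Lemma boundary_holder (F : 'M[R]_n.+1 -> R) (k A a1 B Q H th gam : R)
    (u : 'rV[R]_n.+1 -> R) (q y : 'rV[R]_n.+1) :
  subsolution_bound F k Omega u -> rank1_bound F A a1 ->
  {within K, continuous u} -> k < 2 * A * B -> 0 <= B -> 0 <= H ->
  0 < th <= 1 -> 0 <= gam <= th -> boundary Omega y -> enorm q <= Q ->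
  (forall x z, boundary Omega x -> enclosing_center Omega rho y z ->
    u x - u y - dotp q (x - y) <= H * (2 * depth y z x) `^ th) ->
  forall x, K x -> u x - u y <= d ^+ 3 * (Q + H + B) * enorm (x - y) `^ gam.
Proof.
move=> subu boundF cu BA B0 H0 th01 gth by_ qQ bnd x Kx.
have [z yz] := sphO by_.
have := boundary_estimate domO subu boundF cu BA by_ yz B0 H0 th01 (q := q).
move=> /(_ _ x Kx) h.
have {}h : u x <= u y + dotp q (x - y) + H * (2 * depth y z x) `^ th + B * (2 *
  depth y z x).
  by apply: h => b bb; have := bnd b z bb yz; lra.
have /andP [th0 th1] := th01; have /andP [g0 gle] := gth.
have d1 : 1 <= d by rewrite lerDl mulr_ge0 // ltW.
have rhod : 2 * rho <= d by lra.
have rho2 : 0 <= 2 * rho by rewrite mulr_ge0 // ltW.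
have [Ky _] := (boundaryP domO y).1 by_.
have rd := le_trans (diameter_le domO sphO Kx Ky) rhod.
set r := enorm (x - y) in rd *; set P := r `^ gam.
have r0 : 0 <= r := enorm_ge0 _.
have P0 : 0 <= P := powR_ge0 _ _.
have Q0 : 0 <= Q := le_trans (enorm_ge0 _) qQ.
have dep0 := depth_ge0 yz Kx.
have dep : 2 * depth y z x <= 2 * rho * r.
  by rewrite -mulrA ler_pM2l //; exact: depth_le yz.1.
move: (1 + 2 * rho) d1 rhod rd => D D1 rhoD rD.
have D0 : 0 <= D by lra.
have D2 : 0 <= D ^+ 2 by rewrite sqr_ge0.
have D23 : D ^+ 2 <= D ^+ 3 by rewrite [leRHS]exprS ler_peMl.
have r1 : r <= D ^+ 2 * P.
  have := @powR_compare _ r D gam 1; rewrite r0 rD D1 g0 (le_trans gle th1) ltr01 powRr1 //.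
  by rewrite ler1n; apply.
have rth : (2 * depth y z x) `^ th <= D ^+ 3 * P.
  apply: le_trans (_ : (2 * rho * r) `^ th <= _).
    by apply: ge0_ler_powR; rewrite ?nnegrE ?(ltW th0) ?mulr_ge0 ?(ltW rho0).
  rewrite powRM // exprS -mulrA; apply: ler_pM; rewrite ?powR_ge0 //.
    apply: le_trans (_ : D `^ th <= _).
      by apply: ge0_ler_powR; rewrite ?nnegrE ?(ltW th0).
    by rewrite -[leRHS]powRr1 //; apply: ler_powR.
  apply: powR_compare; rewrite ?r0 ?g0 //.
  by rewrite th0 (le_trans th1) // ler1n.
have D2P : D ^+ 2 * P <= D ^+ 3 * P by apply: ler_wpM2r.
have e1 : dotp q (x - y) <= Q * (D ^+ 3 * P).
  apply: le_trans (dotp_le _ _) _; apply: ler_pM; rewrite ?enorm_ge0 //.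
  exact: le_trans r1 D2P.
have e2 : H * (2 * depth y z x) `^ th <= H * (D ^+ 3 * P) by apply: ler_wpM2l.
have e3 : B * (2 * depth y z x) <= B * (D ^+ 3 * P).
  apply: ler_wpM2l => //; apply: le_trans dep _.
  by rewrite exprS -[leRHS]mulrA; apply: ler_pM.
have -> : D ^+ 3 * (Q + H + B) * P = Q * (D ^+ 3 * P) + H * (D ^+ 3 * P) + B * (D ^+ 3 * P).
  by ring.
lra.
Qed.

Variables (a : 'I_n.+1 -> R) (f u : 'rV[R]_n.+1 -> R) (k : R).
Hypotheses (wa : weights a) (cu : {within K, continuous u}).
Hypothesis visc : viscosity_solution (M_op a) f Omega u.
Hypotheses (k0 : 0 <= k) (fk : forall x, Omega x -> `|f x| <= k).

(** The function [- u] solves the equation of this operator with right-hand side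
    [- f]. *)
Definition dual_op (F : 'M[R]_n.+1 -> R) X := - F (- X).

Lemma subsolution_bound_u : subsolution_bound (M_op a) k Omega u.
Proof.
case: visc => _ [_ sub] _ x xi X Ox sX jet; apply: le_trans (sub x xi X Ox sX jet).
by have := fk Ox; rewrite ler_norml => /andP [].
Qed.

Lemma subsolution_bound_opp :
  subsolution_bound (dual_op (M_op a)) k Omega (fun x => - u x).
Proof.
case: visc => _ _ [_ sup] x xi X Ox sX jet; rewrite lerN2.
apply: le_trans (_ : f x <= k); last by apply: le_trans (ler_norm _) (fk Ox).
apply: (sup x (- xi)) => //; first by rewrite linearN /= sX.
move=> e e0; apply: filterS (jet e e0) => y.
by rewrite /taylor2 mulmxN !dotpNl; lra.
Qed.

Lemma rank1_bound_M_op : rank1_bound (M_op a) (wsum a) (a ord0).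
Proof. by move=> c q p q0; apply: M_op_rank1_le => //; case: wa. Qed.

Lemma rank1_bound_dual : rank1_bound (dual_op (M_op a)) (wsum a) (a ord_max).
Proof.
move=> c q p q0; rewrite /dual_op rank1N.
have := @M_op_rank1_ge _ _ a (- c) (- q) p; rewrite oppr_ge0 => /(_ (proj1 wa) q0); lra.
Qed.

(** Both one-sided boundary estimates hold for every exponent up to [th]; the
    interior step uses the one of [u], [- u] for which the dominant weight
    sits on the radial eigenvalue of the cone.  It is carried out for
    every [B] with [k < 2 |a| B], and then [B] decreases to [k / (2 |a|)]. *)
Lemma global_holder (q : 'rV[R]_n.+1 -> 'rV[R]_n.+1) (Q H th gam : R) :
  0 <= H -> 0 < th <= 1 -> 0 <= gam <= th ->
  what a ord0 <= (1 - gam) * a ord0 \/ what a ord_max <= (1 - gam) * a ord_max ->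
  (forall y, boundary Omega y -> enorm (q y) <= Q) ->
  (forall x y z, boundary Omega x -> boundary Omega y -> enclosing_center Omega rho y z ->
    `|u x - u y - dotp (q y) (x - y)| <= H * (2 * depth y z x) `^ th) ->
  forall x y, K x -> K y -> `|u x - u y| <=
    d ^+ 3 * (2 * Q + 2 * H + 3 / 2 * k / wsum a) * enorm (x - y) `^ gam.
Proof.
move=> H0 th01 gth dom qQ bnd x y Kx Ky.
have A0 := wsum_gt0 wa.
have gam01 : 0 <= gam <= 1.
  by move: th01 gth => /andP [_ th1] /andP [-> /le_trans ->].
have Q0 : 0 <= Q.
  have [b [_ [bb _ _]]] := boundary_two_points domO.
  exact: le_trans (enorm_ge0 _) (qQ b bb).
have d1 : 1 <= d by rewrite lerDl mulr_ge0 // ltW.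
have cNu : {within K, continuous (fun x => - u x)}.
  by move=> t; apply: cvgN; exact: cu.
have strict B : k < 2 * wsum a * B -> `|u x - u y| <=
    d ^+ 3 * (2 * Q + 2 * H + 3 * B) * enorm (x - y) `^ gam.
  move=> BA; have B0 : 0 <= B.
    by rewrite -(pmulr_rge0 _ (_ : 0 < 2 * wsum a)) ?mulr_gt0 // ltW // (le_lt_trans k0).
  pose M := d ^+ 3 * (Q + H + B).
  have M0 : 0 <= M by rewrite mulr_ge0 ?addr_ge0 // exprn_ge0 // (le_trans ler01).
  have bdry w b : K w -> boundary Omega b -> `|u w - u b| <= M * enorm (w - b) `^ gam.
    move=> Kw bb; rewrite ler_norml; apply/andP; split; last first.
      apply: (boundary_holder subsolution_bound_u rank1_bound_M_op cu BA B0 H0 th01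
        gth bb (qQ b bb) _ Kw).
      move=> t z bt bz; exact: le_trans (ler_norm _) (bnd t b z bt bb bz).
    rewrite lerNl opprB -[X in X - _]opprK addrC.
    apply: (boundary_holder subsolution_bound_opp rank1_bound_dual cNu BA B0 H0
      th01 gth bb (q := - q b) _ _ Kw).
      by rewrite enormN qQ.
    move=> t z bt bz; apply: le_trans (bnd t b z bt bb bz).
    rewrite -normrN; apply: le_trans (ler_norm _).
    by rewrite dotpNl; lra.
  have : `|u x - u y| <= (2 * M + B * d ^+ 2) * enorm (x - y) `^ gam.
    case: dom => hat.
      exact: (holder_closure domO rho0 sphO subsolution_bound_u rank1_bound_M_op cu
        BA gam01 M0 B0 hat bdry).
    have := holder_closure domO rho0 sphO subsolution_bound_opp rank1_bound_dual
      cNu BA gam01 M0 B0 hat.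
    move=> /(_ _ x y Kx Ky); rewrite -opprD normrN; apply => w b Kw bb.
    by rewrite -opprD normrN; exact: bdry.
  move/le_trans; apply; apply: ler_wpM2r; first exact: powR_ge0.
  have : B * d ^+ 2 <= d ^+ 3 * B.
    by rewrite mulrC; apply: ler_wpM2r => //; rewrite [leRHS]exprS ler_peMl // sqr_ge0.
  by rewrite /M; lra.
set P := enorm _ `^ gam in strict *; have P0 : 0 <= P := powR_ge0 _ _.
have c0 : 0 <= d ^+ 3 * 3 * P by rewrite mulr_ge0 // mulr_ge0 // exprn_ge0 //
  (le_trans ler01).
move: (d ^+ 3) c0 strict => D c0 strict.
apply/ler_addgt0Pr => e e0.
(* The excess [eta] of [B] over its limit changes the bound by at most [e]. *)
pose eta := e / (D * 3 * P + 1).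
have eta0 : 0 < eta by rewrite divr_gt0 // ltr_wpDl.
have etaE : D * 3 * P * eta <= e.
  rewrite /eta mulrCA ler_piMr ?(ltW e0) // ler_pdivrMr ?mul1r ?ltr_wpDl //.
  by rewrite lerDl.
have A20 : 0 < 2 * wsum a by rewrite mulr_gt0.
have kB : k < 2 * wsum a * (k / (2 * wsum a) + eta).
  rewrite mulrDr mulrCA divff ?mulr1 ?(gt_eqF A20) // ltrDl.
  exact: mulr_gt0 A20 eta0.
apply: le_trans (strict _ kB) _.
have -> : D * (2 * Q + 2 * H + 3 * (k / (2 * wsum a) + eta)) * P =
    D * (2 * Q + 2 * H + 3 / 2 * k / wsum a) * P + D * 3 * P * eta.
  by field; rewrite (gt_eqF A0).
by rewrite lerD2l.
Qed.

End GlobalEstimate.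

(** * Hoelder norms and the theorem *)

Section Norms.
Variables (R : realType) (n : nat).
Implicit Types (D : set 'rV[R]_n.+1).

Lemma le_sup_norm (V : Type) (N : V -> R) D (h : 'rV[R]_n.+1 -> V) x :
  D x -> ((N (h x))%:E <= sup_norm N D h)%E.
Proof. by move=> Dx; apply: ereal_sup_ubound; exists x. Qed.

Lemma sup_norm_le (V : Type) (N : V -> R) D (h : 'rV[R]_n.+1 -> V) c :
  (forall x, D x -> N (h x) <= c) -> (sup_norm N D h <= c%:E)%E.
Proof. by move=> hc; apply: ge_ereal_sup => _ [x Dx <-]; rewrite lee_fin hc. Qed.

Lemma le_hoelder (V : zmodType) (N : V -> R) gam D (h : 'rV[R]_n.+1 -> V) x y s :
  (hoelder_seminorm N gam D h <= s%:E)%E -> D x -> D y -> x != y ->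
  N (h x - h y) <= s * enorm (x - y) `^ gam.
Proof.
move=> hs Dx Dy xy; rewrite -ler_pdivrMr ?powR_gt0 ?enorm_gt0 ?subr_eq0 //.
rewrite -lee_fin; apply: le_trans hs; apply: ereal_sup_ubound.
by exists (x, y).
Qed.

Lemma hoelder_le (V : zmodType) (N : V -> R) gam D (h : 'rV[R]_n.+1 -> V) c :
  (forall x y, D x -> D y -> N (h x - h y) <= c * enorm (x - y) `^ gam) ->
  (hoelder_seminorm N gam D h <= c%:E)%E.
Proof.
move=> hc; apply: ge_ereal_sup => _ [[x y] /= [Dx Dy xy] <-].
by rewrite lee_fin ler_pdivrMr ?powR_gt0 ?enorm_gt0 ?subr_eq0 // hc.
Qed.

Lemma hoelder_subset (V : zmodType) (N : V -> R) gam D D' (h : 'rV[R]_n.+1 -> V) :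
  D `<=` D' -> (hoelder_seminorm N gam D h <= hoelder_seminorm N gam D' h)%E.
Proof.
move=> DD'; apply: ereal_sup_le => _ [p [Dx Dy xy] <-].
by exists p => //; split => //; exact: DD'.
Qed.

Lemma fin_of_ge0 (x : \bar R) : (0 <= x)%E -> (x < +oo)%E ->
  exists2 r, 0 <= r & x = r%:E.
Proof. by case: x => // r; rewrite lee_fin => r0 _; exists r. Qed.

Lemma sup_norm_ge0 (V : Type) (N : V -> R) D (h : 'rV[R]_n.+1 -> V) :
  (forall v, 0 <= N v) -> D !=set0 -> (0 <= sup_norm N D h)%E.
Proof. by move=> N0 [x Dx]; apply: le_trans (le_sup_norm N h Dx); rewrite lee_fin. Qed.

Lemma hoelder_ge0 (V : zmodType) (N : V -> R) gam D (h : 'rV[R]_n.+1 -> V) x y :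
  (forall v, 0 <= N v) -> D x -> D y -> x != y -> (0 <= hoelder_seminorm N gam D h)%E.
Proof.
move=> N0 Dx Dy xy; apply: (@le_trans _ _ (N (h x - h y) / enorm (x - y) `^ gam)%:E).
  by rewrite lee_fin divr_ge0 // powR_ge0.
by apply: ereal_sup_ubound; exists (x, y).
Qed.

End Norms.

Section TaylorOnBoundary.
Variables (R : realType) (n : nat) (Omega : set 'rV[R]_n.+1) (rho : R).
Hypotheses (domO : bounded_domain Omega) (rho0 : 0 < rho).
Hypothesis sphO : sphere_condition rho Omega.
Implicit Types x y z b : 'rV[R]_n.+1.

(** [|x - y|^beta] is at most the power [beta / 2] of twice the depth. *)
Lemma holder_boundary_depth (g : 'rV[R]_n.+1 -> R) s beta x y z : 0 <= s -> 0 < beta ->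
  (hoelder_seminorm (@abs_norm R) beta (boundary Omega) g <= s%:E)%E ->
  boundary Omega x -> boundary Omega y -> enclosing_center Omega rho y z ->
  `|g x - g y| <= s * (2 * depth y z x) `^ (beta / 2).
Proof.
move=> s0 beta0 hs bx by_ yz.
have [->|xy] := eqVneq x y; first by rewrite subrr normr0 mulr_ge0 ?powR_ge0.
apply: le_trans (le_hoelder hs bx by_ xy) _; rewrite ler_wpM2l //.
have [Kx _] := (boundaryP domO x).1 bx.
rewrite enorm_powR; apply: ge0_ler_powR; rewrite ?nnegrE ?dotp_ge0 ?divr_ge0 ?(ltW
  beta0) //.
  by rewrite mulr_ge0 // (depth_ge0 yz Kx).
exact: dist_sqr_le_depth yz Kx.
Qed.

(** The Taylor remainder at [y] has gradient [grad g - grad g y], which is at most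
    [s (7 r)^beta] on the boundary within distance [7 r] of [y]; the boundary
    path has length at most [7 r], with [r] the square root of twice the depth.
    The constant [49] bounds [7^(1 + beta)]. *)
Lemma taylor_boundary_depth (g : 'rV[R]_n.+1 -> R) s beta x y z : (0 < n)%N ->
  0 <= s -> 0 <= beta <= 1 ->
  (forall b, boundary Omega b -> differentiable g b) ->
  (hoelder_seminorm (@enorm R n.+1) beta (boundary Omega) (grad g) <= s%:E)%E ->
  boundary Omega x -> boundary Omega y -> enclosing_center Omega rho y z ->
  `|g x - g y - dotp (grad g y) (x - y)| <= 49 * s * (2 * depth y z x) `^ ((1 + beta) / 2).
Proof.
move=> n0 s0 /andP [beta0 beta1] dg hs bx by_ yz.
have [Kx _] := (boundaryP domO x).1 bx.
have dep0 := depth_ge0 yz Kx.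
set r := Num.sqrt (2 * depth y z x); have r0 : 0 <= r := sqrtr_ge0 _.
have r70 : 0 <= 7 * r by rewrite mulr_ge0.
have := @boundary_variation _ _ _ _ domO rho0 sphO
  (fun w => g w - dotp (grad g y) w) (s * (7 * r) `^ beta) x y z n0.
rewrite mulr_ge0 ?powR_ge0 // => /(_ isT bx by_ yz); rewrite /= -/r => h.
have -> : g x - g y - dotp (grad g y) (x - y) =
    g x - dotp (grad g y) x - (g y - dotp (grad g y) y) by rewrite dotpBr; ring.
apply: le_trans (h _) _ => {h}.
  move=> b bb br e e0; apply: filterS (slope_le_sub_linear (grad g y) (dg b bb) e0) => t.
  move/le_trans; apply; rewrite ler_wpM2r ?enorm_ge0 // lerD2r.
  have [->|by'] := eqVneq b y.
    by rewrite subrr enorm0 mulr_ge0 ?powR_ge0.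
  apply: le_trans (le_hoelder hs bb by_ by') _; rewrite ler_wpM2l //.
  by apply: ge0_ler_powR; rewrite ?nnegrE ?enorm_ge0.
rewrite (mulrC 49) -!mulrA ler_wpM2l //.
have b1 : 1 + beta != 0 by rewrite gt_eqF // ltr_wpDr.
have -> : (7 * r) `^ beta * (7 * r) = (7 * r) `^ (1 + beta).
  by rewrite powRD ?(negbTE b1) // powRr1 // mulrC.
have -> : (2 * depth y z x) `^ ((1 + beta) / 2) = r `^ (1 + beta).
  by rewrite (mulrC (1 + beta)) powRrM powR12_sqrt // mulr_ge0.
rewrite powRM //; apply: ler_wpM2r; first exact: powR_ge0.
have -> : 49 = 7 `^ 2 :> R by rewrite powR_mulrn //; ring.
by apply: ler_powR; lra.
Qed.

End TaylorOnBoundary.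

Section Main.
Variables (R : realType) (n : nat).

(** The last component of the weight data is the mean weight, so the inverted
    quantity is the total weight.  Absolute values keep the constant positive
    for arbitrary arguments. *)
Definition holder_constant (w : R * R * R * R * R) (rho : R) : R :=
  98 * (1 + 2 * `|rho|) ^+ 3 * (1 + `|n.+1%:R * w.2|^-1).

Lemma holder_constant_gt0 w rho : 0 < holder_constant w rho.
Proof.
apply: mulr_gt0; last by rewrite ltr_wpDr // invr_ge0.
by apply: mulr_gt0 => //; apply: exprn_gt0; rewrite // ltr_wpDr // mulr_ge0.
Qed.

Lemma holder_constant_ge (a : 'I_n.+1 -> R) rho Q H k s : weights a -> 0 < rho ->
  0 <= Q -> 0 <= H -> 0 <= k -> 0 <= s ->
  (1 + 2 * rho) ^+ 3 * (2 * Q + 2 * (49 * H) + 3 / 2 * k / wsum a) <=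
  holder_constant (weight_data a) rho * (s + Q + H + k).
Proof.
move=> wa rho0 Q0 H0 k0 s0; have A0 := wsum_gt0 wa.
rewrite /holder_constant /weight_data /= /wmean (mulrC n.+1%:R) divfK ?pnatr_eq0 //.
rewrite (gtr0_norm A0) (gtr0_norm rho0).
have D0 : 0 <= (1 + 2 * rho) ^+ 3 by rewrite exprn_ge0 // addr_ge0 // mulr_ge0 // ltW.
have i0 : 0 <= (wsum a)^-1 by rewrite invr_ge0 ltW.
move: ((1 + 2 * rho) ^+ 3) (wsum a)^-1 D0 i0 => D i D0 i0.
rewrite (mulrC 98) -!mulrA; apply: ler_wpM2l => //; rewrite !mulrA.
have ik : 0 <= k * i by rewrite mulr_ge0.
have ir : 0 <= i * (s + Q + H) by rewrite mulr_ge0 ?addr_ge0.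
have -> : 98 * (1 + i) * (s + Q + H + k) =
  98 * (s + Q + H + k) + 98 * (k * i) + 98 * (i * (s + Q + H)) by ring.
rewrite -(mulrA _ k i); lra.
Qed.

Variables (a : 'I_n.+1 -> R) (Omega : set 'rV[R]_n.+1) (f u : 'rV[R]_n.+1 -> R) (rho : R).
Local Notation K := (closure Omega).
Hypotheses (wa : weights a)
  (dom : what a ord0 <= a ord0 \/ what a ord_max <= a ord_max)
  (domO : bounded_domain Omega) (bf : [bounded f x | x in Omega])
  (cu : {within K, continuous u}) (visc : viscosity_solution (M_op a) f Omega u)
  (rho0 : 0 < rho) (sphO : sphere_condition rho Omega).

Local Notation C := (holder_constant (weight_data a) rho).

Definition holder_conclusion gam (N : \bar R) :=
  (hoelder_seminorm (@abs_norm R) gam K u < +oo)%E /\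
  (hoelder_seminorm (@abs_norm R) gam Omega u <=
    C%:E * (N + sup_norm (@abs_norm R) Omega f))%E.

Lemma sup_norm_rhs : exists2 k, sup_norm (@abs_norm R) Omega f = k%:E &
  0 <= k /\ forall x, Omega x -> `|f x| <= k.
Proof.
have [_ _ O0 _] := domO; have [M [Mr bM]] := bf.
have := sup_norm_ge0 f (@normr_ge0 R R) O0 => sf0.
have [] := fin_of_ge0 sf0.
  apply: le_lt_trans (ltry (M + 1)); apply: sup_norm_le => x Ox.
  by apply: (bM (M + 1)) => //; rewrite ltrDl.
move=> k kk0 ke; exists k => //; split => // x Ox.
by have := le_sup_norm (@abs_norm R) f Ox; rewrite ke lee_fin.
Qed.

Lemma holder_conclusion_intro gam s Q H k :
  sup_norm (@abs_norm R) Omega f = k%:E ->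
  0 <= s -> 0 <= Q -> 0 <= H -> 0 <= k ->
  (forall x y, K x -> K y -> `|u x - u y| <=
    (1 + 2 * rho) ^+ 3 * (2 * Q + 2 * (49 * H) + 3 / 2 * k / wsum a) * enorm (x -
      y) `^ gam) ->
  holder_conclusion gam (s + Q + H)%:E.
Proof.
move=> ke s0 Q0 H0 kk0 hu.
have hK : (hoelder_seminorm (@abs_norm R) gam K u <= (C * (s + Q + H + k))%:E)%E.
  apply: hoelder_le => x y Kx Ky; apply: le_trans (hu x y Kx Ky) _.
  by apply: ler_wpM2r; [exact: powR_ge0 | exact: holder_constant_ge].
split; first exact: le_lt_trans hK (ltry _).
rewrite ke -EFinD -EFinM; apply: le_trans hK; apply: hoelder_subset.
exact: subset_closure.
Qed.

Lemma holder_estimate_C beta gam g : 0 < beta <= 1 -> 0 <= gam <= beta / 2 ->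
  gam <= alpha a -> (C_norm beta (boundary Omega) g < +oo)%E ->
  (forall x, boundary Omega x -> u x = g x) ->
  holder_conclusion gam (C_norm beta (boundary Omega) g).
Proof.
move=> /andP [beta0 beta1] gbeta galpha gfin ug.
have [y1 [y2 [b1 b2 y12]]] := boundary_two_points domO.
have [k ke [kk0 fk]] := sup_norm_rhs.
have s0 : (0 <= sup_norm (@abs_norm R) (boundary Omega) g)%E.
  by apply: sup_norm_ge0; [exact: normr_ge0 | exists y1].
have h0 := hoelder_ge0 beta g (@normr_ge0 R R) b1 b2 y12.
move: gfin; rewrite /C_norm => gfin.
have [|s ss0 se] := fin_of_ge0 s0.
  by apply: le_lt_trans gfin; rewrite leeDl.
have [|h hh0 he] := fin_of_ge0 h0.
  by apply: le_lt_trans gfin; rewrite leeDr.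
rewrite se he -EFinD -[s]addr0; apply: (holder_conclusion_intro ke) => //.
have dw := dominant_weight wa dom galpha.
have th01 : 0 < beta / 2 <= 1 by rewrite divr_gt0 //=; lra.
have := @global_holder _ _ _ _ domO rho0 sphO a f u k wa cu visc kk0 fk (fun=> 0) 0 h
  (beta / 2) gam hh0 th01 gbeta dw.
move=> H x y Kx Ky; apply: le_trans (H _ _ x y Kx Ky) _.
- by move=> w _; rewrite enorm0.
- move=> w w' z bw bw' wz; rewrite dotp0l subr0 !ug //.
  by apply: holder_boundary_depth bw bw' wz => //; rewrite -he.
apply: ler_wpM2r; first exact: powR_ge0.
apply: ler_wpM2l; first by rewrite exprn_ge0 // addr_ge0 // mulr_ge0 // ltW.
by lra.
Qed.

(** The finiteness of the norm of the data on the boundary is part of the proof: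
    [g] is bounded there because it equals [u], and the gradient because its
    Hoelder seminorm is finite and the domain is bounded. *)
Lemma holder_estimate_C1 beta gam g : (0 < n)%N -> 0 <= beta <= 1 ->
  0 <= gam <= (1 + beta) / 2 ->
  gam <= alpha a -> C1_near beta (boundary Omega) g ->
  (forall x, boundary Omega x -> u x = g x) ->
  holder_conclusion gam (C1_norm beta (boundary Omega) g).
Proof.
move=> n0 beta01 gbeta galpha [N [oN bN dg cg gfin]] ug.
have [y1 [y2 [b1 b2 y12]]] := boundary_two_points domO.
have [k ke [kk0 fk]] := sup_norm_rhs.
have bdK b : boundary Omega b -> K b by move=> /(boundaryP domO) [].
have s0 : (0 <= sup_norm (@abs_norm R) (boundary Omega) g)%E.
  by apply: sup_norm_ge0; [exact: normr_ge0 | exists y1].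
have q0 : (0 <= sup_norm (@enorm R n.+1) (boundary Omega) (grad g))%E.
  by apply: sup_norm_ge0; [exact: enorm_ge0 | exists y1].
have h0 := hoelder_ge0 beta (grad g) (@enorm_ge0 R n.+1) b1 b2 y12.
have [|h hh0 he] := fin_of_ge0 h0.
  by apply: le_lt_trans gfin; exact: hoelder_subset.
have hs : (hoelder_seminorm (@enorm R n.+1) beta (boundary Omega) (grad g) <= h%:E)%E.
  by rewrite he.
have [|s ss0 se] := fin_of_ge0 s0.
  have K0 : K !=set0 by exists y1; exact: bdK.
  have cK := compact_closure domO.
  have [c1 _ max1] := compact_EVT_max K0 cK cu.
  have [c2 _ min2] := compact_EVT_min K0 cK cu.
  apply: le_lt_trans (ltry (`|u c1| + `|u c2|)); apply: sup_norm_le => x bx.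
  rewrite -ug // /abs_norm ler_norml.
  have xK : x \in K by rewrite inE; exact: bdK.
  have := max1 x xK; have := min2 x xK; have := ler_norm (u c1); have := ler_norm (- u c2).
  rewrite normrN; have := normr_ge0 (u c1); have := normr_ge0 (u c2); lra.
have [|q qq0 qe] := fin_of_ge0 q0.
  apply: le_lt_trans (ltry (enorm (grad g y1) + h * ((1 + 2 * rho) ^+ 2))).
  apply: sup_norm_le => x bx.
  have [->|xy] := eqVneq x y1.
    by rewrite lerDl mulr_ge0 // sqr_ge0.
  rewrite -[grad g x](subrK (grad g y1)) addrC; apply: le_trans (ler_enormD _ _) _.
  rewrite lerD2l; apply: le_trans (le_hoelder hs bx b1 xy) _.
  apply: ler_wpM2l => //.
  have d1 : 1 <= 1 + 2 * rho by rewrite lerDl mulr_ge0 // ltW.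
  have d0 : 0 <= 1 + 2 * rho := le_trans ler01 d1.
  have dx : enorm (x - y1) <= 1 + 2 * rho.
    by apply: le_trans (diameter_le domO sphO (bdK x bx) (bdK _ b1)) _; rewrite lerDr.
  apply: le_trans (_ : (1 + 2 * rho) `^ beta <= _).
    have /andP [beta0 _] := beta01.
    by apply: ge0_ler_powR; rewrite ?nnegrE ?enorm_ge0 ?d0.
  by rewrite -powR_mulrn //; apply: ler_powR => //; lra.
rewrite /C1_norm se qe he -!EFinD; apply: (holder_conclusion_intro ke) => //.
have dw := dominant_weight wa dom galpha.
have th01 : 0 < (1 + beta) / 2 <= 1 by lra.
have h49 : 0 <= 49 * h by rewrite mulr_ge0.
apply: (@global_holder _ _ _ _ domO rho0 sphO a f u k wa cu visc kk0 fk (grad g) q (49 * h)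
  ((1 + beta) / 2) gam h49 th01 gbeta dw).
- by move=> b bb; have := le_sup_norm (@enorm R n.+1) (grad g) bb; rewrite qe lee_fin.
move=> x y z bx by_ yz; rewrite !ug //.
apply: taylor_boundary_depth bx by_ yz => //.
by move=> b /bN; exact: dg.
Qed.

End Main.

Theorem theorem1p4 (R : realType) (n : nat) :
  exists (CA : R * R * R * R * R -> R -> R -> R)
         (CA' : R * R * R * R * R -> R -> R -> R -> R)
         (CB : R * R * R * R * R -> R -> R -> R)
         (CB' : R * R * R * R * R -> R -> R -> R -> R),
    [/\ forall w rho beta, 0 < CA w rho beta,
        forall w rho beta L, 0 < CA' w rho beta L,
        forall w rho al, 0 < CB w rho al &
        forall w rho al L, 0 < CB' w rho al L] /\
  forall (a : 'I_n.+1 -> R) (Omega : set 'rV[R]_n.+1)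
         (f u : 'rV[R]_n.+1 -> R) (rho : R),
    weights a ->
    what a ord0 <= a ord0 \/ what a ord_max <= a ord_max ->
    bounded_domain Omega ->
    {within Omega, continuous f} ->
    [bounded f x | x in Omega] ->
    {within closure Omega, continuous u} ->
    viscosity_solution (M_op a) f Omega u ->
    0 < rho ->
    sphere_condition rho Omega ->
  [/\ forall (beta : R) (g : 'rV[R]_n.+1 -> R),
        0 < beta <= 1 ->
        (C_norm beta (boundary Omega) g < +oo)%E ->
        (forall x, boundary Omega x -> u x = g x) ->
        let gamma := Num.min (alpha a) (beta / 2) in
        (hoelder_seminorm (@abs_norm R) gamma (closure Omega) u < +oo)%E /\
        (hoelder_seminorm (@abs_norm R) gamma Omega u <=
          (CA (weight_data a) rho beta)%:E *
          (C_norm beta (boundary Omega) g + sup_norm (@abs_norm R) Omega f))%E,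
      forall (L beta : R) (g : 'rV[R]_n.+1 -> R),
        (0 < n)%N ->
        uniform_lipschitz_boundary L Omega ->
        0 <= beta < 1 ->
        C1_near beta (boundary Omega) g ->
        (forall x, boundary Omega x -> u x = g x) ->
        let gamma := Num.min (alpha a) ((1 + beta) / 2) in
        (hoelder_seminorm (@abs_norm R) gamma (closure Omega) u < +oo)%E /\
        (hoelder_seminorm (@abs_norm R) gamma Omega u <=
          (CA' (weight_data a) rho beta L)%:E *
          (C1_norm beta (boundary Omega) g + sup_norm (@abs_norm R) Omega f))%E,
      forall (g : 'rV[R]_n.+1 -> R),
        0 < alpha a <= 2^-1 ->
        (C_norm (2 * alpha a) (boundary Omega) g < +oo)%E ->
        (forall x, boundary Omega x -> u x = g x) ->
        (hoelder_seminorm (@abs_norm R) (alpha a) (closure Omega) u < +oo)%E /\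
        (hoelder_seminorm (@abs_norm R) (alpha a) Omega u <=
          (CB (weight_data a) rho (alpha a))%:E *
          (C_norm (2 * alpha a) (boundary Omega) g
           + sup_norm (@abs_norm R) Omega f))%E &
      forall (L : R) (g : 'rV[R]_n.+1 -> R),
        (0 < n)%N ->
        uniform_lipschitz_boundary L Omega ->
        2^-1 <= alpha a <= 1 ->
        C1_near (2 * alpha a - 1) (boundary Omega) g ->
        (forall x, boundary Omega x -> u x = g x) ->
        (hoelder_seminorm (@abs_norm R) (alpha a) Omega u <=
          (CB' (weight_data a) rho (alpha a) L)%:E *
          (C1_norm (2 * alpha a - 1) (boundary Omega) g
           + sup_norm (@abs_norm R) Omega f))%E].
Proof.
exists (fun w rho _ => holder_constant n w rho), (fun w rho _ _ => holder_constant n w rho),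
  (fun w rho _ => holder_constant n w rho), (fun w rho _ _ => holder_constant n w rho).
split; first by split=> *; exact: holder_constant_gt0.
move=> a Omega f u rho wa dom domO _ bf cu visc rho0 sphO.
have [al0 _] := alpha_attained wa dom.
split.
- move=> beta g /[dup] beta01 /andP [beta0 _] gfin ug gamma.
  have gle : 0 <= gamma <= beta / 2.
    by rewrite le_min al0 divr_ge0 ?(ltW beta0) //= ge_min lexx orbT.
  have gal : gamma <= alpha a by rewrite ge_min lexx.
  exact: (holder_estimate_C wa dom domO bf cu visc rho0 sphO beta01 gle gal gfin ug).
- move=> _ beta g n0 _ /andP [beta0 beta1] gnear ug gamma.
  have beta01 : 0 <= beta <= 1 by rewrite beta0 ltW.
  have gle : 0 <= gamma <= (1 + beta) / 2.
    by rewrite le_min al0 divr_ge0 ?addr_ge0 //= ge_min lexx orbT.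
  have gal : gamma <= alpha a by rewrite ge_min lexx.
  exact: (holder_estimate_C1 wa dom domO bf cu visc rho0 sphO n0 beta01 gle gal gnear ug).
- move=> g al gfin ug.
  have beta01 : 0 < 2 * alpha a <= 1 by lra.
  have gle : 0 <= alpha a <= 2 * alpha a / 2 by lra.
  exact: (holder_estimate_C wa dom domO bf cu visc rho0 sphO beta01 gle (lexx _) gfin ug).
move=> _ g n0 _ al gnear ug.
have beta01 : 0 <= 2 * alpha a - 1 <= 1 by lra.
have gle : 0 <= alpha a <= (1 + (2 * alpha a - 1)) / 2 by lra.
by have [] := holder_estimate_C1 wa dom domO bf cu visc rho0 sphO n0 beta01 gle
  (lexx _) gnear ug.
Qed.
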